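(* For each fixed $d\ge2$ there are constants $C_d<\infty$ and $\varepsilon_d>0$, depending only on $d$, with the following property. Let $q=\frac{2d}{d+1}$, $n\ge1$, $\mathbb K\in\{\mathbb R,\mathbb C\}$, and let $T:(\mathbb K^n)^d\to\mathbb K$ be a $d$-linear form with \[ \|T\|_{\mathrm{cb}}=1,\qquad \|T\|_q\ge1-\varepsilon,\qquad 0\le\varepsilon\le\varepsilon_d . \] Then there are an integer $1\le m\le n$, sets $J_1,\ldots,J_d\subseteq[n]$ with $|J_1|=\cdots=|J_d|=m$, and unimodular matrices $H_r$ over $\mathbb K$ indexed by $J_r\times J_{r+1}$, $r=1,\ldots,d-1$, such that, putting $J=J_1\times\cdots\times J_d$ and letting $P$ be the $d$-linear form with \[ P(e_{i_1},\ldots,e_{i_d})=m^{-(d+1)/2}\prod_{r=1}^{d-1}H_r(i_r,i_{r+1})\quad((i_1,\ldots,i_d)\in J), \] and $P(e_{i_1},\ldots,e_{i_d})=0$ for $(i_1,\ldots,i_d)\notin J$, one has \[ \|T-P\|_q\le C_d\sqrt\varepsilon,\qquad \|P\|_q=1, \] and \[ \sum_{(i_1,\ldots,i_d)\in[n]^d\setminus J}|T(e_{i_1},\ldots,e_{i_d})|^q\le C_d\,\varepsilon . \]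
   Context: $[n]=\{1,\dots,n\}$ and $e_1,\dots,e_n$ is the canonical basis of $\mathbb K^n$. The coefficient norm is $\|T\|_q=\big(\sum_{i_1,\ldots,i_d=1}^n|T(e_{i_1},\ldots,e_{i_d})|^q\big)^{1/q}$. The completely bounded norm is \[ \|T\|_{\mathrm{cb}}=\sup_{\mathcal H}\ \sup_{(X_j^s)}\Big\|\sum_{i_1,\ldots,i_d=1}^n T(e_{i_1},\ldots,e_{i_d})\,X^1_{i_1}X^2_{i_2}\cdots X^d_{i_d}\Big\|_{\mathcal B(\mathcal H)}, \] where $\mathcal H$ ranges over all Hilbert spaces over $\mathbb K$ and $(X_j^s)_{s\in[d],\,j\in[n]}$ over all families of bounded linear operators on $\mathcal H$ with operator norm $\le1$ (not necessarily commuting; products are compositions in the displayed order). A matrix is unimodular if all its entries have modulus one. *)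

(* Defs.v *)
From mathcomp Require Import all_boot all_order all_algebra.
From mathcomp Require Import sesquilinear.
From mathcomp.real_closed Require Import complex.
From mathcomp Require Import all_classical all_reals all_analysis.
Set Implicit Arguments.
Unset Strict Implicit.
Unset Printing Implicit Defensive.
Import Order.TTheory GRing.Theory Num.Theory.
Import numFieldNormedType.Exports.
Local Open Scope classical_set_scope.
Local Open Scope ring_scope.

Variant scalar_kind := RealScalars | ComplexScalars.

Definition scalars (R : realType) (k : scalar_kind) : numFieldType :=
  match k with RealScalars => R | ComplexScalars => R[i] end.

Definition conj (R : realType) (k : scalar_kind) : scalars R k -> scalars R k :=
  match k return scalars R k -> scalars R k with
  | RealScalars => fun x => x
  | ComplexScalars => fun z : R[i] => conjc z
  end.

(* The norm of a numFieldType takes its values in the field itself;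
   [modulus] is the real-valued absolute value. *)
Definition modulus (R : realType) (k : scalar_kind) : scalars R k -> R :=
  match k return scalars R k -> R with
  | RealScalars => fun x : R => `|x|
  | ComplexScalars => fun z : R[i] => Normc.normc z
  end.

Definition of_real (R : realType) (k : scalar_kind) : R -> scalars R k :=
  match k return R -> scalars R k with
  | RealScalars => fun x => x
  | ComplexScalars => fun x => real_complex R x
  end.

Record hilbertSpace (R : realType) (k : scalar_kind) := HilbertSpace {
  hilbert_sort :> completeNormedModType (scalars R k);
  inner : {dot hilbert_sort for @conj R k};
  innerE : forall x, inner x x = `|x| ^+ 2 }.

Definition opnorm (R : realType) (k : scalar_kind) (H : hilbertSpace R k)
    (A : H -> H) : \bar R :=
  ereal_sup [set (modulus `|A x|)%:E | x in [set x : H | `|x| <= 1]].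

Section Forms.
Variables (R : realType) (k : scalar_kind) (d n : nat).
Local Notation K := (scalars R k).
Implicit Types (T : {ffun 'I_d -> 'rV[K]_n} -> K) (i : {ffun 'I_d -> 'I_n}).

Definition multilinear T : Prop :=
  forall (s : 'I_d) (x : {ffun 'I_d -> 'rV[K]_n}),
    scalar (fun u : 'rV[K]_n => T [ffun t => if t == s then u else x t]).

Definition coef T i : K := T [ffun s => delta_mx 0 (i s)].

Definition coef_norm (q : R) T : R :=
  (\sum_i modulus (coef T i) `^ q) `^ q^-1.

(* The iterated composition is X 0 (i 0) \o (X 1 (i 1) \o ...), i.e., the
   operator product in the order of the indices. *)
Definition form_apply T (H : hilbertSpace R k)
    (X : 'I_d -> 'I_n -> {linear H -> H}) : H -> H :=
  fun x => \sum_i coef T i *: (\big[comp/idfun]_(s < d) (X s (i s) : H -> H)) x.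

Definition cb_norm T : \bar R :=
  ereal_sup [set N | exists (H : hilbertSpace R k)
                            (X : 'I_d -> 'I_n -> {linear H -> H}),
                       (forall s j, (opnorm (X s j) <= 1)%E) /\
                       N = opnorm (form_apply T X)].

Definition box (J : 'I_d -> {set 'I_n}) : {set {ffun 'I_d -> 'I_n}} :=
  [set i : {ffun 'I_d -> 'I_n} | [forall s, i s \in J s]]%SET.

End Forms.

(* For a family indexed by 'I_d, the consecutive pairs of indices are
   (link_src r, link_tgt r) = (r, r + 1), r ranging over 'I_d.-1. *)
Definition link_src (d : nat) (r : 'I_d.-1) : 'I_d := widen_ord (leq_pred d) r.

Lemma link_tgt_subproof (d : nat) (r : 'I_d.-1) : (r.+1 < d)%N.
Proof. by rewrite -ltn_predRL. Qed.

Definition link_tgt (d : nat) (r : 'I_d.-1) : 'I_d :=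
  Ordinal (link_tgt_subproof r).

(* Main.v *)
Require Import Defs.
From HB Require Import structures.
From mathcomp Require Import all_boot all_order all_algebra.
From mathcomp Require Import sesquilinear.
From mathcomp.real_closed Require Import complex.
From mathcomp Require Import all_classical all_reals all_analysis.
From mathcomp Require Import ring lra.
Set Implicit Arguments.
Unset Strict Implicit.
Unset Printing Implicit Defensive.
Import Order.TTheory GRing.Theory Num.Theory.
Import numFieldNormedType.Exports.
Local Open Scope classical_set_scope.
Local Open Scope ring_scope.

(** The completely bounded norm is used through one inequality for each coordinate s. For
    a fixed value of i_s, the coefficients T(e_i) form a matrix with rows (i_1, ...,
    i_(s-1)) and columns (i_(s+1), ..., i_d). If the operators to the right of s create
    basis vectors, those to the left of s annihilate them, and those at s are arbitrary
    contractions, then testing with them shows that the trace norms of all these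
    matrices add up to at most |T|_cb. A trace norm is at least the Hilbert-Schmidt norm
    p_s(j), with equality only in rank at most one; [slice_norm_minors] is an algebraic
    version of this, in which the gain is a sum of squared 2 x 2 minors.

    Moduli. Put w = |T(e_i)|. Then w^q is the geometric mean of the d + 1 arrays
    w^2 / p_s(i_s) and prod_s p_s(i_s), and each of them has sum at most 1. If the sum of
    w^q is at least 1 - eta, then the square roots of these arrays are within O(sqrt eta)
    of each other in l2 ([dens_close]). Consequently p_s(i_s) and p_t(i_t) are nearly equal
    at independent random places, so that all p_s concentrate near one value c^2
    ([exists_pivot]) and w is nearly constant on a box. Its sides have the same length
    up to a relative error O(eta), because the sum of w^2 over the box can be computed by
    slicing at any coordinate ([core_card_upper], [core_card_lower]). So they can be
    trimmed to a common size m at the cost of O(eta) of the mass ([modulus_stability]).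

    Phases. The slice inequality has only O(eta) left for the minors, so each slice is
    nearly of rank one: for each s the phases nearly factor into a function of
    i_1, ..., i_s and a function of i_s, ..., i_d ([phase_split]). Combining these
    factorizations over all s, as for a Markov chain, yields a product of unimodular
    functions of consecutive coordinates ([phase_chain]).

    Relative to the size of T, all errors are O(eta) for squared l2 norms. Hoelder's inequality
    on the m^d points of the box turns this into O(sqrt eta) for the norm with exponent q,
    while the sum outside the box stays O(eta). *)

(** * Real and complex scalars *)

Section Scalars.
Variables (R : realType) (k : scalar_kind).
Local Notation K := (scalars R k).
Implicit Types x y : K.

Lemma of_real_zmod_morphism : zmod_morphism (@of_real R k).
Proof. by case: k => // a b; apply: rmorphB. Qed.
HB.instance Definition _ :=
  GRing.isZmodMorphism.Build R K (@of_real R k) of_real_zmod_morphism.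

Lemma of_real_monoid_morphism : monoid_morphism (@of_real R k).
Proof. by case: k; split=> // a b; apply: rmorphM. Qed.
HB.instance Definition _ :=
  GRing.isMonoidMorphism.Build R K (@of_real R k) of_real_monoid_morphism.

Lemma conj_zmod_morphism : zmod_morphism (@conj R k).
Proof. by case: k => // a b; apply: rmorphB. Qed.
HB.instance Definition _ :=
  GRing.isZmodMorphism.Build K K (@conj R k) conj_zmod_morphism.

Lemma conj_monoid_morphism : monoid_morphism (@conj R k).
Proof.
by case: k; split=> //= [|a b]; [exact: (rmorph1 (@conjc R))|exact: rmorphM].
Qed.
HB.instance Definition _ :=
  GRing.isMonoidMorphism.Build K K (@conj R k) conj_monoid_morphism.

Lemma conjK : involutive (@conj R k).
Proof. by case: k => //=; apply: conjcK. Qed.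

Lemma conj_of_real (r : R) : conj (of_real k r) = of_real k r.
Proof. by case: k => //=; rewrite oppr0. Qed.

Lemma ler_of_real (a b : R) : (of_real k a <= of_real k b) = (a <= b).
Proof. by case: k => //=; rewrite lecR. Qed.

Lemma norm_modulus x : `|x| = of_real k (modulus x).
Proof. by move: x; case: k. Qed.

Lemma of_real_inj : injective (@of_real R k).
Proof. exact: fmorph_inj. Qed.

Lemma mulr_conj x : x * conj x = of_real k (modulus x ^+ 2).
Proof.
rewrite rmorphXn /= -norm_modulus; move: x; case: k => /= x.
  by rewrite real_normK ?num_real.
by rewrite sqr_normc.
Qed.

Lemma modulus_ge0 x : 0 <= modulus x.
Proof. by rewrite -ler_of_real rmorph0 -norm_modulus. Qed.

Lemma modulusM x y : modulus (x * y) = modulus x * modulus y.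
Proof. by apply: of_real_inj; rewrite rmorphM /= -!norm_modulus normrM. Qed.

Lemma modulus_eq0 x : (modulus x == 0) = (x == 0).
Proof. by rewrite -(inj_eq of_real_inj) rmorph0 -norm_modulus normr_eq0. Qed.

Lemma modulus0 : modulus (0 : K) = 0.
Proof. by apply/eqP; rewrite modulus_eq0. Qed.

Lemma modulus1 : modulus (1 : K) = 1.
Proof. by apply: of_real_inj; rewrite rmorph1 -norm_modulus normr1. Qed.

Lemma modulusN x : modulus (- x) = modulus x.
Proof. by apply: of_real_inj; rewrite -!norm_modulus normrN. Qed.

Lemma modulusB x y : modulus (x - y) = modulus (y - x).
Proof. by rewrite -modulusN opprB. Qed.

Lemma ler_modulusD x y : modulus (x + y) <= modulus x + modulus y.
Proof. by rewrite -ler_of_real rmorphD /= -!norm_modulus ler_normD. Qed.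

Lemma modulus_conj x : modulus (conj x) = modulus x.
Proof.
apply/eqP; rewrite -(eqrXn2 (n := 2)) ?modulus_ge0 //; apply/eqP.
by apply: of_real_inj; rewrite -!mulr_conj conjK mulrC.
Qed.

Lemma modulus_of_real (r : R) : modulus (of_real k r) = `|r|.
Proof.
apply/eqP; rewrite -(eqrXn2 (n := 2)) ?modulus_ge0 //; apply/eqP.
by apply: of_real_inj; rewrite -mulr_conj conj_of_real real_normK ?num_real // rmorphXn.
Qed.

Lemma modulusV x : modulus x^-1 = (modulus x)^-1.
Proof. by apply: of_real_inj; rewrite fmorphV /= -!norm_modulus normfV. Qed.

Lemma modulus_prod (I : finType) (P : pred I) (F : I -> K) :
  modulus (\prod_(i | P i) F i) = \prod_(i | P i) modulus (F i).
Proof. by apply: big_morph; [exact: modulusM|exact: modulus1]. Qed.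

(** In the partial order of R[i], the elements comparable with 0 are real; this turns the
    epsilons of a field-valued norm into real ones. *)
Lemma gt0_of_real (e : K) : 0 < e -> exists2 r : R, 0 < r & e = of_real k r.
Proof.
move=> e0; exists (modulus e); last by rewrite -norm_modulus gtr0_norm.
by rewrite lt_def modulus_ge0 andbT modulus_eq0 gt_eqF.
Qed.

End Scalars.

(** The complex numbers are complete because the real and imaginary parts of a
    Cauchy filter converge. *)
Lemma complex_cauchy_cvg (R : realType)
    (F : set_system (scalars R ComplexScalars)) :
  ProperFilter F -> cauchy F -> cvg F.
Proof.
move=> FF /cauchyP Fc.
have part (p : R[i] -> R) : (forall x y, `|p x - p y|%:C <= `|x - y|)%C ->
    cvg (p @ F).
  move=> pB; apply/cauchy_cvgP/cauchy_exP => e e0.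
  have e0C : (0 < e%:C)%C by rewrite ltcR.
  have [x Fx] := Fc _ e0C.
  exists (p x); rewrite /nbhs /=; apply: filterS Fx => y.
  rewrite -!ball_normE /= => xy; rewrite -ltcR; exact: le_lt_trans (pB _ _) xy.
have cRe : cvg ((@complex.Re R) @ F).
  by apply: part => x y; rewrite -raddfB; apply: complex.normc_ge_Re.
have cIm : cvg ((@complex.Im R) @ F).
  apply: part => x y.
  have -> : complex.Im x - complex.Im y = - complex.Re ((x - y) * 'i%C).
    by rewrite ReiNIm opprK; case: x y => [? ?] [? ?].
  rewrite normrN; apply: le_trans (complex.normc_ge_Re _) _.
  by rewrite normrM complexiE normCi mulr1.
apply/cvg_ex; exists (lim (@complex.Re R @ F) +i* lim (@complex.Im R @ F))%C.
apply/cvgrPdist_lt => e /(@gt0_of_real R ComplexScalars)[r r0 ->].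
have r20 : 0 < r / 2 by rewrite divr_gt0.
move/cvgrPdist_lt/(_ _ r20) : cRe => nRe; move/cvgrPdist_lt/(_ _ r20) : cIm => nIm.
near=> x.
have -> : ((lim (@complex.Re R @ F) +i* lim (@complex.Im R @ F)) - x)%C
   = ((lim (@complex.Re R @ F) - complex.Re x)%:C
      + 'i%C * (lim (@complex.Im R @ F) - complex.Im x)%:C)%C.
  by rewrite [LHS]complexE; case: (x) => ? ?.
apply: le_lt_trans (ler_normD _ _) _; rewrite normrM complexiE normCi mul1r.
rewrite !normc_def /= !expr0n !addr0 !sqrtr_sqr -rmorphD /= ltcR.
by rewrite [r]splitr; apply: ltrD; near: x.
Unshelve. all: by end_near. Qed.

Lemma scalars_cauchy_cvg (R : realType) (k : scalar_kind)
    (F : set_system (scalars R k)) :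
  ProperFilter F -> cauchy F -> cvg F.
Proof.
case: k F => F FF; first exact: (@cauchy_cvg R).
exact: complex_cauchy_cvg.
Qed.

(** * Finite-dimensional Hilbert spaces *)

(** Lagrange's identity: the difference of the two sides is half of
    sum_(i, j) (x_i y_j - x_j y_i)^2. *)
Lemma cauchy_schwarz_sum (R : realFieldType) (I : finType) (P : pred I) (x y : I -> R) :
  (\sum_(i | P i) x i * y i) ^+ 2
    <= (\sum_(i | P i) x i ^+ 2) * (\sum_(i | P i) y i ^+ 2).
Proof.
have : 0 <= \sum_(i | P i) \sum_(j | P j) (x i * y j - x j * y i) ^+ 2.
  by do 2!apply: sumr_ge0 => ? _; exact: sqr_ge0.
have -> : \sum_(i | P i) \sum_(j | P j) (x i * y j - x j * y i) ^+ 2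
  = \sum_(i | P i) \sum_(j | P j) x i ^+ 2 * y j ^+ 2
    + \sum_(i | P i) \sum_(j | P j) y i ^+ 2 * x j ^+ 2
    - 2 * \sum_(i | P i) \sum_(j | P j) (x i * y i) * (x j * y j).
  rewrite mulr_sumr -big_split -sumrB /=; apply: eq_bigr => i _.
  rewrite mulr_sumr -big_split -sumrB /=; apply: eq_bigr => j _; ring.
rewrite -!big_distrlr /=; lra.
Qed.

Lemma sum_sqrD_le (R : rcfType) (I : finType) (P : pred I) (x y : I -> R) :
  Num.sqrt (\sum_(i | P i) (x i + y i) ^+ 2)
    <= Num.sqrt (\sum_(i | P i) x i ^+ 2) + Num.sqrt (\sum_(i | P i) y i ^+ 2).
Proof.
have s0 (z : I -> R) : 0 <= \sum_(i | P i) z i ^+ 2.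
  by apply: sumr_ge0 => ? _; exact: sqr_ge0.
rewrite -[leRHS]ger0_norm ?addr_ge0 ?sqrtr_ge0 // -sqrtr_sqr.
apply: ler_wsqrtr; rewrite sqrrD !sqr_sqrtr ?s0 //.
have -> : \sum_(i | P i) (x i + y i) ^+ 2 = \sum_(i | P i) x i ^+ 2
    + (\sum_(i | P i) x i * y i) *+ 2 + \sum_(i | P i) y i ^+ 2.
  by rewrite -sumrMnl -!big_split /=; apply: eq_bigr => i _; rewrite sqrrD.
rewrite lerD2r lerD2l lerMn2r /= -sqrtrM ?s0 //.
by apply: le_trans (ler_norm _) _; rewrite -sqrtr_sqr ler_wsqrtr ?cauchy_schwarz_sum.
Qed.

(* an alias, so that this norm does not compete with other structures on {ffun I -> _} *)
Definition l2 (R : realType) (k : scalar_kind) (I : finType) : Type :=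
  {ffun I -> scalars R k}.

Section L2.
Variables (R : realType) (k : scalar_kind) (I : finType).
Local Notation K := (scalars R k).
Local Notation E := (l2 R k I).

HB.instance Definition _ := GRing.Lmodule.copy E {ffun I -> K}.

Lemma l2D (u v : E) i : (u + v) i = u i + v i. Proof. exact: ffunE. Qed.
Lemma l2Z (a : K) (u : E) i : (a *: u) i = a * u i. Proof. exact: ffunE. Qed.
Lemma l2N (u : E) i : (- u) i = - u i. Proof. exact: ffunE. Qed.
Lemma l20 i : (0 : E) i = 0. Proof. exact: ffunE. Qed.

Lemma l2_sum (J : Type) (r : seq J) (P : pred J) (F : J -> E) i :
  (\sum_(j <- r | P j) F j) i = \sum_(j <- r | P j) F j i.
Proof.
by elim/big_rec2: _ => [|j u v _ <-]; rewrite ?l20 // l2D.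
Qed.

Definition sqnorm (u : E) : R := \sum_i modulus (u i) ^+ 2.
Definition l2norm (u : E) : K := of_real k (Num.sqrt (sqnorm u)).

Lemma sqnorm_ge0 u : 0 <= sqnorm u.
Proof. by apply: sumr_ge0 => i _; exact: sqr_ge0. Qed.

Lemma ler_l2normD (u v : E) : l2norm (u + v) <= l2norm u + l2norm v.
Proof.
rewrite /l2norm -rmorphD /= ler_of_real; apply: le_trans (sum_sqrD_le _ _ _).
apply: ler_wsqrtr; apply: ler_sum => i _.
by rewrite lerXn2r ?nnegrE ?addr_ge0 ?modulus_ge0 // l2D ler_modulusD.
Qed.

Lemma l2normZ (a : K) (u : E) : l2norm (a *: u) = `|a| * l2norm u.
Proof.
rewrite /l2norm norm_modulus -rmorphM /=; congr of_real.
rewrite -[modulus a]ger0_norm ?modulus_ge0 // -sqrtr_sqr -sqrtrM ?sqr_ge0 //.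
by congr Num.sqrt; rewrite mulr_sumr; apply: eq_bigr => i _; rewrite l2Z modulusM exprMn.
Qed.

Lemma l2norm_eq0 (u : E) : l2norm u = 0 -> u = 0.
Proof.
move/eqP; rewrite fmorph_eq0 sqrtr_eq0 => u0.
have {u0} : sqnorm u == 0 by rewrite eq_le u0 sqnorm_ge0.
rewrite psumr_eq0 => [|i _]; last exact: sqr_ge0.
move/allP => u0; apply/ffunP => i; rewrite l20.
by have := u0 i (mem_index_enum i); rewrite /= sqrf_eq0 modulus_eq0 => /eqP.
Qed.

HB.instance Definition _ :=
  @Lmodule_isNormed.Build K E l2norm ler_l2normD l2normZ l2norm_eq0.

Lemma l2normE (u : E) : `|u| = of_real k (Num.sqrt (sqnorm u)).
Proof. by []. Qed.

Lemma ler_coord_l2norm (u : E) i : `|u i| <= `|u|.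
Proof.
rewrite l2normE norm_modulus ler_of_real -{1}(ger0_norm (modulus_ge0 _)) -sqrtr_sqr.
apply: ler_wsqrtr; rewrite /sqnorm (bigD1 i) //= lerDl.
by apply: sumr_ge0 => j _; exact: sqr_ge0.
Qed.

Lemma ler_l2norm_sum (u : E) : `|u| <= \sum_i `|u i|.
Proof.
rewrite (eq_bigr _ (fun i _ => norm_modulus (u i))) -rmorph_sum l2normE ler_of_real /=.
have s0 : 0 <= \sum_i modulus (u i) by apply: sumr_ge0 => i _; exact: modulus_ge0.
rewrite -[leRHS]ger0_norm // -sqrtr_sqr; apply: ler_wsqrtr.
rewrite expr2 mulr_suml; apply: ler_sum => i _; rewrite expr2.
apply: ler_wpM2l; first exact: modulus_ge0.
by rewrite (bigD1 i) //= lerDl; apply: sumr_ge0 => j _; exact: modulus_ge0.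
Qed.

Lemma l2_cauchy_cvg (F : set_system E) : ProperFilter F -> cauchy F -> cvg F.
Proof.
move=> FF /cauchyP Fc.
have cv i : cvg ((fun u : E => u i) @ F).
  apply: scalars_cauchy_cvg; apply: cauchy_exP => e e0.
  have [u Fu] := Fc e e0; exists (u i); rewrite /nbhs /=; apply: filterS Fu => v.
  rewrite -!ball_normE /= => uv; apply: le_lt_trans uv.
  by have := ler_coord_l2norm (u - v) i; rewrite l2D l2N.
apply/cvg_ex; exists [ffun i => lim ((fun u : E => u i) @ F)].
apply/cvgrPdist_lt => e e0.
have e'0 : 0 < e / #|I|.+1%:R by rewrite divr_gt0 ?ltr0Sn.
have near_all : F [set u : E | forall i,
    `|lim ((fun u : E => u i) @ F) - u i| < e / #|I|.+1%:R].
  by apply: filter_forall => i; move/cvgrPdist_lt/(_ _ e'0) : (cv i).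
apply: filterS near_all => u ui; apply: le_lt_trans (ler_l2norm_sum _) _.
apply: (@le_lt_trans _ _ (\sum_(i : I) e / #|I|.+1%:R)).
  by apply: ler_sum => i _; rewrite l2D l2N ffunE ltW ?ui.
rewrite sumr_const -[ltLHS]mulr_natr -mulrA -[ltRHS]mulr1 ltr_pM2l //.
by rewrite mulrC ltr_pdivrMr ?ltr0Sn // mul1r ltr_nat.
Qed.

HB.instance Definition _ := Uniform_isComplete.Build E l2_cauchy_cvg.

Definition l2_inner (u v : E) : K := \sum_i u i * conj (v i).

Lemma l2_innerE (u : E) : l2_inner u u = `|u| ^+ 2.
Proof.
rewrite l2normE -rmorphXn /= sqr_sqrtr ?sqnorm_ge0 // rmorph_sum /=.
by apply: eq_bigr => i _; exact: mulr_conj.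
Qed.

Lemma l2_inner_bilinear :
  bilinear_for (GRing.Scale.Law.clone _ _ *%R _)
    (GRing.Scale.Law.clone _ _ (@conj R k \; *%R) _) l2_inner.
Proof.
split=> [v|u] a x y /=; rewrite /l2_inner mulr_sumr -big_split /=;
  apply: eq_bigr => i _; rewrite l2D l2Z.
- by rewrite mulrDl mulrA.
- by rewrite rmorphD rmorphM /= mulrDr mulrCA.
Qed.
HB.instance Definition _ :=
  bilinear_isBilinear.Build K E E K _ _ l2_inner l2_inner_bilinear.

Lemma l2_inner_sym (u v : E) : l2_inner u v = (-1) ^+ false * conj (l2_inner v u).
Proof.
rewrite expr0 mul1r rmorph_sum; apply: eq_bigr => i _.
by rewrite rmorphM /= conjK mulrC.
Qed.
HB.instance Definition _ :=
  isHermitianSesquilinear.Build K E false (@conj R k) l2_inner l2_inner_sym.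

Lemma l2_inner_gt0 (u : E) : u != 0 -> 0 < l2_inner u u.
Proof. by move=> u0; rewrite l2_innerE exprn_gt0 ?normr_gt0. Qed.
HB.instance Definition _ := isDotProduct.Build K E l2_inner l2_inner_gt0.

Definition l2_hilbert : hilbertSpace R k :=
  @HilbertSpace R k E l2_inner l2_innerE.

End L2.

(** * Contractions of l2 *)

Section Operators.
Variables (R : realType) (k : scalar_kind) (I : finType).
Local Notation K := (scalars R k).
Local Notation E := (l2 R k I).

Lemma sqnorm_inner (u : E) : of_real k (sqnorm u) = l2_inner u u.
Proof. by rewrite l2_innerE l2normE -rmorphXn /= sqr_sqrtr ?sqnorm_ge0. Qed.

Lemma contraction_opnorm (A : l2_hilbert R k I -> l2_hilbert R k I) :
  (forall v : E, sqnorm (A v : E) <= sqnorm v) -> (opnorm A <= 1)%E.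
Proof.
move=> Ac; apply: ge_ereal_sup => _ [v /= v1 <-]; rewrite lee_fin.
rewrite -(ler_of_real k) -norm_modulus normr_id rmorph1.
apply: le_trans v1; rewrite l2normE (l2normE v) ler_of_real.
exact/ler_wsqrtr/Ac.
Qed.

Definition basis_vec (x0 : I) : E := [ffun x => (x == x0)%:R].

Lemma sqnorm_basis_vec x0 : sqnorm (basis_vec x0) = 1.
Proof.
rewrite /sqnorm (bigD1 x0) //= ffunE eqxx modulus1 expr1n big1 ?addr0 // => x xx0.
by rewrite ffunE (negPf xx0) modulus0 expr0n.
Qed.

Lemma opnorm_coord (A : l2_hilbert R k I -> l2_hilbert R k I) (x y : I) :
  (opnorm A <= 1)%E -> modulus ((A (basis_vec y) : E) x) <= 1.
Proof.
move=> A1; rewrite -(ler_of_real k) -norm_modulus rmorph1.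
apply: le_trans (ler_coord_l2norm _ _) _.
rewrite l2normE -(rmorph1 (@of_real R k)) ler_of_real -lee_fin.
rewrite -[Num.sqrt _]ger0_norm ?sqrtr_ge0 // -(modulus_of_real k) -l2normE.
apply: le_trans A1; apply: ereal_sup_ubound; exists (basis_vec y) => //=.
by rewrite l2normE sqnorm_basis_vec sqrtr1 rmorph1.
Qed.

(** Pulling vectors back along a partial injection is a partial isometry. *)
Definition pull (c : pred I) (tau : I -> I) (v : E) : E :=
  [ffun x => if c x then v (tau x) else 0].

Lemma pull_is_linear c tau : linear (pull c tau).
Proof.
move=> a u v; apply/ffunP => x; rewrite l2D l2Z !ffunE.
by case: ifP => _; rewrite ?l2D ?l2Z // mulr0 addr0.
Qed.
HB.instance Definition _ c tau :=
  GRing.isLinear.Build K E E *:%R (pull c tau) (pull_is_linear c tau).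

Lemma pull_contraction (c : pred I) tau v :
  {in c &, injective tau} -> sqnorm (pull c tau v) <= sqnorm v.
Proof.
move=> tauI; rewrite /sqnorm (bigID c) /= [X in _ + X]big1 ?addr0; last first.
  by move=> x /negPf xc; rewrite ffunE xc modulus0 expr0n.
under eq_bigr => x xc do rewrite ffunE xc.
have -> : \sum_(x | c x) modulus (v (tau x)) ^+ 2
    = \sum_(x in [set x | c x]%SET) modulus (v (tau x)) ^+ 2.
  by apply: eq_bigl => x; rewrite inE.
rewrite -(big_imset (fun y => modulus (v y) ^+ 2)) /=; last first.
  by move=> x y; rewrite !inE; exact: tauI.
rewrite [leRHS](bigID (mem (tau @: [set x | c x]%SET))) /= lerDl.
by apply: sumr_ge0 => x _; exact: sqr_ge0.
Qed.

Definition kernel_op (A : I -> I -> K) (v : E) : E :=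
  [ffun x => \sum_y A x y * v y].

Lemma kernel_op_is_linear A : linear (kernel_op A).
Proof.
move=> a u v; apply/ffunP => x; rewrite l2D l2Z !ffunE mulr_sumr -big_split /=.
by apply: eq_bigr => y _; rewrite l2D l2Z mulrDr mulrCA.
Qed.
HB.instance Definition _ A :=
  GRing.isLinear.Build K E E *:%R (kernel_op A) (kernel_op_is_linear A).

Lemma kernel_op_basis_vec A x y : kernel_op A (basis_vec y) x = A x y.
Proof.
rewrite ffunE (bigD1 y) //= ffunE eqxx mulr1 big1 ?addr0 // => z zy.
by rewrite ffunE (negPf zy) mulr0.
Qed.

Definition adjoint (A : I -> I -> K) : I -> I -> K := fun x y => conj (A y x).

Lemma adjointP A (u v : E) :
  l2_inner (kernel_op A u) v = l2_inner u (kernel_op (adjoint A) v).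
Proof.
rewrite /l2_inner; under eq_bigr => x _ do rewrite ffunE mulr_suml.
rewrite exchange_big /=; apply: eq_bigr => y _.
rewrite ffunE rmorph_sum mulr_sumr; apply: eq_bigr => x _.
by rewrite rmorphM /= conjK; ring.
Qed.

Lemma kernel_op_contraction A (v : E) :
  \sum_x \sum_y modulus (A x y) ^+ 2 <= 1 -> sqnorm (kernel_op A v) <= sqnorm v.
Proof.
move=> A1; apply: (@le_trans _ _ (\sum_x (\sum_y modulus (A x y) ^+ 2) * sqnorm v)).
  apply: ler_sum => x _; apply: le_trans (cauchy_schwarz_sum _ _ _).
  rewrite lerXn2r ?nnegrE ?modulus_ge0 ?sumr_ge0 // => [y _|].
    by rewrite mulr_ge0 ?modulus_ge0.
  rewrite ffunE; under [leRHS]eq_bigr => y _ do rewrite -modulusM.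
  elim/big_ind2: _ => [|x1 x2 y1 y2 h1 h2|//]; first by rewrite modulus0.
  by apply: le_trans (ler_modulusD _ _) _; rewrite lerD.
by rewrite -mulr_suml ler_piMl ?sqnorm_ge0.
Qed.

(** The best contraction to pair with A is the unitary factor of its polar decomposition,
    which gives the trace norm of A. The operator (3 A - A A^* A)/2 is an algebraic
    substitute: it turns a singular value s of A into (3 s - s^3)/2, which lies between s
    and 1 if s is in [0, 1]. If A has Hilbert-Schmidt norm 1, then pairing it with A gives
    more than 1 unless A has rank one. *)
Definition polar (A : I -> I -> K) (v : E) : E :=
  (3 / 2) *: kernel_op A v
  - 2^-1 *: kernel_op A (kernel_op (adjoint A) (kernel_op A v)).

Lemma polar_is_linear A : linear (polar A).
Proof.
move=> a u v; rewrite /polar !linearP /=; apply/ffunP => x.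
by rewrite !(l2D, l2Z, l2N); ring.
Qed.
HB.instance Definition _ A :=
  GRing.isLinear.Build K E E *:%R (polar A) (polar_is_linear A).

Lemma polar_contraction A (v : E) :
  \sum_x \sum_y modulus (A x y) ^+ 2 <= 1 -> sqnorm (polar A v) <= sqnorm v.
Proof.
(* with B = A^* A, the claim is |v|^2 - |U v|^2 = <(4 - B) (1 - B) v, (1 - B) v> / 4 *)
move=> A1; set B := fun w => kernel_op (adjoint A) (kernel_op A w).
pose y : E := v - B v.
suff id4 : 4 * (sqnorm v - sqnorm (polar A v)) = 4 * sqnorm y - sqnorm (kernel_op A y).
  have := kernel_op_contraction y A1; have := sqnorm_ge0 y; lra.
apply: (@of_real_inj R k).
rewrite !(rmorphB, rmorphM, rmorph_nat) /= !sqnorm_inner /polar /y.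
have adj' u w : l2_inner u (kernel_op A w) = l2_inner (kernel_op (adjoint A) u) w.
  by rewrite [LHS]l2_inner_sym adjointP [RHS]l2_inner_sym.
have conj32 : conj (3 / 2 : K) = 3 / 2 by rewrite fmorph_div !rmorph_nat.
have conj2 : conj (2^-1 : K) = 2^-1 by rewrite fmorphV !rmorph_nat.
rewrite !linearB /= !(linearBl, linearBr) !(linearZl_LR, linearZr_LR) /= conj32 conj2.
rewrite -!/(B v).
have -> : l2_inner v (B v) = l2_inner (kernel_op A v) (kernel_op A v) by rewrite adjointP.
have -> : l2_inner (B v) v = l2_inner (kernel_op A v) (kernel_op A v) by rewrite adj'.
have -> : l2_inner (kernel_op A v) (kernel_op A (B v)) = l2_inner (B v) (B v) by rewrite adj'.
have -> : l2_inner (kernel_op A (B v)) (kernel_op A v) = l2_inner (B v) (B v) by rewrite adjointP.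
have scaleE (a b : K) : a *: b = a * b by [].
move: (l2_inner _ _) (l2_inner _ _) (l2_inner _ _) (l2_inner _ _) => b1 b2 b3 b4.
by rewrite !scaleE; field.
Qed.

End Operators.

(** * Test operators *)

Section TestOperators.
Variables (R : realType) (k : scalar_kind) (d n : nat) (j0 : 'I_n).
Local Notation K := (scalars R k).
Local Notation I := {ffun 'I_d -> 'I_n}.
Local Notation E := (l2 R k I).
Implicit Types (x y i : I) (s t : 'I_d).

Definition upd x t (j : 'I_n) : I := [ffun r => if r == t then j else x r].
Definition below (m : nat) i : I := [ffun t : 'I_d => if (t < m)%N then i t else j0].
Definition above (m : nat) i : I := [ffun t : 'I_d => if (m <= t)%N then i t else j0].

Lemma upd_inj_in t j (c : I -> bool) :
  (forall x y, c x -> c y -> x t = y t) ->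
  {in [pred x | c x] &, injective (fun x => upd x t j)}.
Proof.
move=> ct x y; rewrite !inE => cx cy /ffunP xy; apply/ffunP => r.
have := xy r; rewrite !ffunE; case: eqP => [-> _|//]; exact: ct.
Qed.

Variables (s : 'I_d) (U : 'I_n -> {linear E -> E}).

(** Read E as the d-fold tensor power of K^n, with e_j0 as the vacuum in each factor. The
    operators at the places after s create e_j in their own factor, those at the places
    before s annihilate it, and the one at s is free. *)
Definition test_op t (j : 'I_n) : {linear E -> E} :=
  if t == s then U j
  else if (t < s)%N
    then pull (fun x => x t == j0) (fun x => upd x t j) : {linear E -> E}
    else pull (fun x => x t == j) (fun x => upd x t j0) : {linear E -> E}.

Lemma test_op_contraction t j v :
  (forall v, sqnorm (U j v) <= sqnorm v) -> sqnorm (test_op t j v) <= sqnorm v.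
Proof.
move=> Uc; rewrite /test_op; case: ifP => // _.
case: ifP => _; apply: pull_contraction; apply: upd_inj_in => x y; 
  by move=> /eqP xj /eqP yj; apply: val_inj; rewrite xj yj.
Qed.

(** The operators after s write the coordinates of i after s into the vacuum, and those
    before s read off the coordinates before s; so any family of contractions U_j can be
    tested against the coefficients, with rows and columns indexed by these two halves. *)
Lemma test_op_prodE i :
  (\big[comp/idfun]_(t < d) (test_op t (i t) : E -> E)) (basis_vec R k [ffun => j0])
     [ffun => j0]
  = U (i s) (basis_vec R k (above s.+1 i)) (below s i).
Proof.
pose F m : E -> E := if insub m is Some t then test_op t (i t) else idfun.
have -> : \big[comp/idfun]_(t < d) (test_op t (i t) : E -> E)
    = \big[comp/idfun]_(0 <= m < d) F m.
  by rewrite big_mkord; apply: eq_bigr => t _; rewrite /F valK.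
have FE t : F t = test_op t (i t) by rewrite /F valK.
(* after the factors m, ..., d - 1 with m > s *)
have right m : (s < m)%N -> (m <= d)%N ->
    (\big[comp/idfun]_(m <= l < d) F l) (basis_vec R k [ffun => j0]) = basis_vec R k (above m i).
  move=> sm md; rewrite -(subKn md); have := leq_subr m d.
  have : (d - m < d - s)%N by rewrite ltn_sub2l // (leq_trans sm).
  elim: (d - m)%N => [|l IH] lds lm.
    rewrite subn0 big_geq //=; congr basis_vec; apply/ffunP => t; rewrite !ffunE.
    by rewrite leqNgt ltn_ord.
  have ld : (d - l.+1 < d)%N by rewrite ltn_subrL /= (leq_ltn_trans _ lm).
  have dl : (d - l.+1).+1 = (d - l)%N by rewrite subnSK.
  rewrite big_ltn //= dl IH ?(ltnW lm) // ?(ltnW lds) //.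
  rewrite -[(d - l.+1)%N]/(nat_of_ord (Ordinal ld)) FE /test_op.
  have sl : (s < d - l.+1)%N by rewrite ltn_subRL addnC -ltn_subRL.
  rewrite -val_eqE /= gtn_eqF // ltnNge (ltnW sl) /=.
  apply/ffunP => x; rewrite !ffunE /= -dl.
  have -> : (x == above (d - l.+1) i) =
      (x (Ordinal ld) == i (Ordinal ld)) && (upd x (Ordinal ld) j0 == above (d - l.+1).+1 i).
    apply/eqP/andP => [->|[/eqP xl /eqP/ffunP xE]].
      split; first by rewrite ffunE /= leqnn.
      apply/eqP/ffunP => t; rewrite !ffunE -val_eqE /=.
      by rewrite [(_ <= t)%N]leq_eqVlt eq_sym; case: eqP => [->|//]; rewrite ltnn.
    apply/ffunP => t; have := xE t; rewrite !ffunE.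
    case: (eqVneq t (Ordinal ld)) => [-> _|tl ->]; first by rewrite leqnn.
    by rewrite [in RHS]leq_eqVlt eq_sym -[(_ == _)%N]/(t == Ordinal ld) (negPf tl).
  by case: eqP.
(* after the factors s - m, ..., d - 1 *)
have left m : (m <= s)%N ->
    (\big[comp/idfun]_(s - m <= l < d) F l) (basis_vec R k [ffun => j0]) (below (s - m) i)
    = U (i s) (basis_vec R k (above s.+1 i)) (below s i).
  elim: m => [|m IH] ms.
    rewrite subn0 big_ltn ?ltn_ord //= right ?ltn_ord // FE.
    by rewrite /test_op eqxx.
  have sm : (s - m.+1 < s)%N by rewrite ltn_subrL /= (leq_ltn_trans _ ms).
  have lt : (s - m.+1 < d)%N := ltn_trans sm (ltn_ord s).
  have sE : (s - m.+1).+1 = (s - m)%N by rewrite subnSK.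
  rewrite big_ltn //= sE -[X in F X]/(nat_of_ord (Ordinal lt)) FE /test_op.
  rewrite -val_eqE /= ltn_eqF // sm /= ffunE /= ffunE /= ltnn eqxx -(IH (ltnW ms)).
  congr (_ _); apply/ffunP => t; rewrite !ffunE -sE ltnS.
  case: (eqVneq t (Ordinal lt)) => [->|tl]; first by rewrite leqnn.
  by rewrite [in RHS]leq_eqVlt -[(_ == _)%N]/(t == Ordinal lt) (negPf tl).
have := left s (leqnn s); rewrite subnn => <-; congr (_ _).
Qed.

End TestOperators.

(** * Exchanging coordinates *)

Section Splice.
Variables (d n : nat).
Local Notation I := {ffun 'I_d -> 'I_n}.
Implicit Types (x y i : I) (s t : 'I_d).

Definition mix (Q : pred 'I_d) x y : I := [ffun t : 'I_d => if Q t then x t else y t].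

Lemma mixK Q x y : mix Q (mix Q x y) (mix Q y x) = x.
Proof. by apply/ffunP => t; rewrite !ffunE; case: ifP => ->. Qed.

(** Exchanging some coordinates of two independent points is an involution on pairs of
    points, hence preserves double sums. *)
Lemma sum_mix (V : nmodType) Q (P : pred I) (F : I -> I -> V) :
  (forall x y, P x -> P y -> P (mix Q x y)) ->
  \sum_(x | P x) \sum_(y | P y) F (mix Q x y) (mix Q y x)
  = \sum_(x | P x) \sum_(y | P y) F x y.
Proof.
move=> PQ; rewrite !pair_big /= [RHS](reindex_inj
  (can_inj (_ : involutive (fun z => (mix Q z.1 z.2, mix Q z.2 z.1))))) /=; last first.
  by case=> x y /=; rewrite !mixK.
apply: eq_bigl => -[x y] /=; apply/andP/andP => -[Px Py]; first by split; apply: PQ.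
by split; [rewrite -(mixK Q x y)|rewrite -(mixK Q y x)]; apply: PQ.
Qed.

Definition splice (s : nat) x y : I := mix (fun t => (t <= s)%N) x y.

Lemma spliceK s x y : splice s (splice s x y) (splice s y x) = x.
Proof. exact: mixK. Qed.

Lemma splice_at s x y : splice s x y s = x s.
Proof. by rewrite ffunE leqnn. Qed.

Lemma sum_splice_pred1 (V : nmodType) s j (F : I -> I -> V) :
  \sum_(x : I | x s == j) \sum_(y : I | y s == j) F (splice s x y) (splice s y x)
  = \sum_(x : I | x s == j) \sum_(y : I | y s == j) F x y.
Proof. by apply: sum_mix => x y xj _; rewrite splice_at. Qed.
End Splice.

(** * The slice inequality *)

Section SliceNorm.
Variables (R : rcfType) (d n : nat).
Local Notation I := {ffun 'I_d -> 'I_n}.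
Implicit Types (w : I -> R) (s : 'I_d) (j : 'I_n).

Definition slice_norm w s j : R := Num.sqrt (\sum_(i : I | i s == j) w i ^+ 2).

Lemma slice_norm_ge0 w s j : 0 <= slice_norm w s j. Proof. exact: sqrtr_ge0. Qed.

Lemma slice_norm_sqr w s j : slice_norm w s j ^+ 2 = \sum_(i : I | i s == j) w i ^+ 2.
Proof. by rewrite sqr_sqrtr // sumr_ge0 // => i _; exact: sqr_ge0. Qed.

Lemma ler_slice_norm w s (i : I) : 0 <= w i -> w i <= slice_norm w s (i s).
Proof.
move=> wi; rewrite -{1}(ger0_norm wi) -sqrtr_sqr; apply: ler_wsqrtr.
rewrite (bigD1 i) //= lerDl.
by apply: sumr_ge0 => i' _; exact: sqr_ge0.
Qed.

End SliceNorm.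

Section SliceMinors.
Variables (R : realType) (k : scalar_kind) (d n : nat).
Local Notation K := (scalars R k).
Local Notation I := {ffun 'I_d -> 'I_n}.
Variable a : I -> K.
Implicit Types (i : I) (s : 'I_d) (j : 'I_n).
Local Notation w := (fun i => modulus (a i)).

(** Fixing the value j of the coordinate s leaves a matrix whose rows are indexed by the
    coordinates before s and whose columns are indexed by those after s. Splicing i and i'
    exchanges their columns, so each summand is a 2 x 2 minor of this matrix. *)
Definition slice_minors s j : R :=
  \sum_(i : I | i s == j) \sum_(i' : I | i' s == j)
    modulus (a i * a i' - a (splice s i i') * a (splice s i' i)) ^+ 2.

(** For a matrix A with Hilbert-Schmidt norm p this is the identity
    sum |minors|^2 = 2 p^4 - 2 tr (A A^* A A^* ). *)
Lemma slice_minorsE s j :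
  of_real k (slice_minors s j)
  = 2 * of_real k (slice_norm w s j ^+ 4)
    - 2 * \sum_(i : I | i s == j) \sum_(i' : I | i' s == j)
        a i * a i' * conj (a (splice s i i') * a (splice s i' i)).
Proof.
pose z i i' := a i * a i'; pose z' i i' := a (splice s i i') * a (splice s i' i).
have zz : \sum_(i : I | i s == j) \sum_(i' : I | i' s == j) z i i' * conj (z i i')
    = of_real k (slice_norm w s j ^+ 4).
  rewrite -[4%N]/(2 * 2)%N exprM slice_norm_sqr expr2 big_distrlr rmorph_sum /=.
  apply: eq_bigr => i _; rewrite rmorph_sum; apply: eq_bigr => i' _.
  by rewrite mulr_conj modulusM exprMn.
have ww : \sum_(i : I | i s == j) \sum_(i' : I | i' s == j) z' i i' * conj (z' i i')
    = of_real k (slice_norm w s j ^+ 4).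
  by rewrite -zz -(sum_splice_pred1 _ _ (fun i i' => z i i' * conj (z i i'))).
have wz : \sum_(i : I | i s == j) \sum_(i' : I | i' s == j) z' i i' * conj (z i i')
    = \sum_(i : I | i s == j) \sum_(i' : I | i' s == j) z i i' * conj (z' i i').
  rewrite -(sum_splice_pred1 _ _ (fun i i' => z i i' * conj (z' i i'))).
  by do 2!apply: eq_bigr => ? _; rewrite /z' !spliceK.
rewrite [in LHS]rmorph_sum /=.
transitivity (\sum_(i : I | i s == j) \sum_(i' : I | i' s == j) (z i i' * conj (z i i')
    + z' i i' * conj (z' i i') - z i i' * conj (z' i i') - z' i i' * conj (z i i'))).
  apply: eq_bigr => i _; rewrite rmorph_sum; apply: eq_bigr => i' _ /=.
  by rewrite -mulr_conj rmorphB /= -/(z i i') -/(z' i i'); ring.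
under [LHS]eq_bigr => i _ do rewrite !sumrB big_split /=.
by rewrite !sumrB big_split /= zz ww wz /z /z'; ring.
Qed.

End SliceMinors.

Section CbTest.
Variables (R : realType) (k : scalar_kind) (d n : nat).
Local Notation K := (scalars R k).
Local Notation I := {ffun 'I_d -> 'I_n}.
Local Notation E := (l2 R k I).
Variable T : {ffun 'I_d -> 'rV[K]_n} -> K.
Hypothesis T1 : (cb_norm T <= 1)%E.
Implicit Types (i : I) (s : 'I_d) (j : 'I_n).

Lemma cb_norm_test (j0 : 'I_n) s (U : 'I_n -> {linear E -> E}) :
  (forall j v, sqnorm (U j v) <= sqnorm v) ->
  modulus (\sum_i coef T i * U (i s) (basis_vec R k (above j0 s.+1 i)) (below j0 s i)) <= 1.
Proof.
move=> Uc; pose X t j : {linear l2_hilbert R k I -> l2_hilbert R k I} := test_op j0 s U t j.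
have X1 : (opnorm (form_apply T X) <= 1)%E.
  apply: le_trans T1; apply: ereal_sup_ubound.
  exists (l2_hilbert R k I), X; split=> // t j.
  by apply: contraction_opnorm => v; apply: test_op_contraction => w; exact: Uc.
have := opnorm_coord [ffun => j0] [ffun => j0] X1; congr (modulus _ <= 1).
rewrite /form_apply l2_sum; apply: eq_bigr => i _.
by rewrite l2Z -(test_op_prodE j0 s U i).
Qed.

End CbTest.

Lemma polar_pairing_identity (F : numFieldType) (P Q : F) : P != 0 ->
  3 / 2 * (P ^+ 2 / P) - Q / (2 * P ^+ 3) = P + (2 * P ^+ 4 - 2 * Q) / (4 * P ^+ 3).
Proof. by move=> P0; field. Qed.

Section SliceInequality.
Variables (R : realType) (k : scalar_kind) (d n : nat).
Local Notation K := (scalars R k).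
Local Notation I := {ffun 'I_d -> 'I_n}.
Local Notation E := (l2 R k I).
Variables (T : {ffun 'I_d -> 'rV[K]_n} -> K) (j0 : 'I_n) (s : 'I_d).
Hypothesis T1 : (cb_norm T <= 1)%E.
Implicit Types (i x y : I) (j : 'I_n).
Local Notation a := (coef T).
Local Notation p := (slice_norm (fun i => modulus (a i)) s).
Local Notation lo := (below j0 s).
Local Notation hi := (above j0 s.+1).

Let glue x j y : I :=
  [ffun t : 'I_d => if (t < s)%N then x t else if t == s then j else y t].

Let glue_lo_hi i i' : i s = i' s -> glue (lo i) (i s) (hi i') = splice s i i'.
Proof.
move=> ii'; apply/ffunP => t; rewrite !ffunE.
rewrite -val_eqE /=; case: ltngtP => //= ts.
by congr (i _); apply: val_inj.
Qed.

Let lo_glue x j y : x = lo x -> lo (glue x j y) = x.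
Proof.
by move=> /ffunP xE; apply/ffunP => t; have := xE t; rewrite !ffunE; case: ifP.
Qed.

Let hi_glue x j y : y = hi y -> hi (glue x j y) = y.
Proof.
move=> /ffunP yE; apply/ffunP => t; have := yE t; rewrite !ffunE.
by rewrite -val_eqE /=; case: ltngtP.
Qed.

(* a point with value j at s is a pair of a row and a column, both padded by j0 *)
Let sum_halves (V : nmodType) j (G : I -> I -> V) :
  \sum_(x : I | x == lo x) \sum_(y : I | y == hi y) G x y
  = \sum_(i : I | i s == j) G (lo i) (hi i).
Proof.
rewrite pair_big /= (reindex_onto (fun i : I => (lo i, hi i))
    (fun z : I * I => glue z.1 j z.2)) /=; last first.
  by case=> x y /= /andP[/eqP xl /eqP yh]; rewrite lo_glue ?hi_glue.
apply: eq_bigl => i; apply/andP/eqP => [[_ /eqP <-]|<-].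
  by rewrite ffunE ltnn eqxx.
rewrite glue_lo_hi //; split; last by apply/eqP/ffunP => t; rewrite ffunE if_same.
by apply/andP; split; apply/eqP/ffunP => t; rewrite !ffunE; case: ifP.
Qed.

(* the slice at j of the conjugate coefficients, normalized to have
   Hilbert-Schmidt norm one *)
Let A j x y : K :=
  if (x == lo x) && (y == hi y) then conj (a (glue x j y)) / of_real k (p j) else 0.

Let A_lo_hi i i' : i s = i' s ->
  A (i s) (lo i) (hi i') = conj (a (splice s i i')) / of_real k (p (i s)).
Proof.
move=> ii'; rewrite /A glue_lo_hi // ifT //; apply/andP; split; apply/eqP/ffunP => t;
  by rewrite !ffunE; case: ifP.
Qed.

Let splicexx i : splice s i i = i.
Proof. by apply/ffunP => t; rewrite ffunE if_same. Qed.

Let sumA (V : nmodType) j (G : I -> I -> V) :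
  (forall x y, A j x y = 0 -> G x y = 0) ->
  \sum_x \sum_y G x y = \sum_(i : I | i s == j) G (lo i) (hi i).
Proof.
move=> G0; rewrite -sum_halves [LHS](bigID (fun x => x == lo x)) /= [X in _ + X]big1 ?addr0.
  apply: eq_bigr => x xl; rewrite (bigID (fun y => y == hi y)) /= [X in _ + X]big1 ?addr0 //.
  by move=> y /negPf yh; apply: G0; rewrite /A yh andbF.
by move=> x /negPf xl; apply: big1 => y _; apply: G0; rewrite /A xl.
Qed.

Let A_hs j : \sum_x \sum_y modulus (A j x y) ^+ 2 <= 1.
Proof.
rewrite (sumA (j := j)) => [|x y ->]; last by rewrite modulus0 expr0n.
have -> : \sum_(i : I | i s == j) modulus (A j (lo i) (hi i)) ^+ 2
    = \sum_(i : I | i s == j) modulus (a i) ^+ 2 * (p j) ^- 2.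
  apply: eq_bigr => i /eqP <-; rewrite A_lo_hi // splicexx modulusM modulus_conj.
  by rewrite modulusV modulus_of_real ger0_norm ?slice_norm_ge0 // exprMn exprVn.
rewrite -mulr_suml -slice_norm_sqr.
have [->|p0] := eqVneq (p j) 0; first by rewrite expr0n mul0r ler01.
by rewrite mulfV ?expf_neq0.
Qed.

Let polarA_coord i : polar (A (i s)) (basis_vec R k (hi i)) (lo i)
  = 3 / 2 * (conj (a i) / of_real k (p (i s)))
    - (\sum_(i' : I | i' s == i s) a i' * conj (a (splice s i i') * a (splice s i' i)))
      / of_real k (2 * p (i s) ^+ 3).
Proof.
rewrite /polar l2D l2N !l2Z kernel_op_basis_vec A_lo_hi // splicexx; congr (_ - _).
rewrite ffunE.
under eq_bigr => y _ do rewrite ffunE mulr_sumr.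
rewrite exchange_big /= (sumA (j := i s)) => [|x y xy0]; last first.
  by rewrite /adjoint xy0 rmorph0 mul0r mulr0.
rewrite mulr_sumr mulr_suml; apply: eq_bigr => i' /eqP i'i.
rewrite kernel_op_basis_vec /adjoint A_lo_hi // -i'i !A_lo_hi // splicexx !rmorphM /=.
rewrite conjK fmorphV /= conj_of_real rmorph_nat !invfM; ring.
Qed.

(** The trace norms of the slices at s add up to at most the completely bounded norm.
    Testing with [polar] keeps the two leading terms of each trace norm: the
    Hilbert-Schmidt norm, and a gain that measures the distance to rank one. *)
Lemma slice_norm_minors :
  \sum_j (p j + slice_minors a s j / (4 * p j ^+ 3)) <= 1.
Proof.
have := cb_norm_test T1 j0 s (U := fun j => polar (A j) : {linear E -> E})
  (fun j v => polar_contraction v (A_hs j)).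
rewrite [X in modulus X](_ : _
    = of_real k (\sum_j (p j + slice_minors a s j / (4 * p j ^+ 3)))).
  rewrite modulus_of_real; exact: le_trans (ler_norm _).
rewrite rmorph_sum (partition_big (fun i : I => i s) xpredT) //=.
apply: eq_bigr => j _.
have [p0|p0] := eqVneq (p j) 0.
  rewrite p0 expr0n mulr0 invr0 mulr0 addr0 rmorph0 big1 // => i /eqP ij.
  suff -> : a i = 0 by rewrite mul0r.
  apply/eqP; rewrite -modulus_eq0 -sqrf_eq0.
  have : p j ^+ 2 == 0 by rewrite p0 expr0n.
  rewrite slice_norm_sqr psumr_eq0 => [/allP/(_ i (mem_index_enum i))|i' _].
    by rewrite ij eqxx.
  exact: sqr_ge0.
have P0 : of_real k (p j) != 0 by rewrite fmorph_eq0.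
rewrite (eq_bigr (fun i => 3 / 2 * (of_real k (modulus (a i) ^+ 2) / of_real k (p j))
  - (\sum_(i' : I | i' s == j) a i * a i' * conj (a (splice s i i') * a (splice s i' i)))
      / of_real k (2 * p j ^+ 3))) => [|i /eqP ij]; last first.
  rewrite polarA_coord ij mulrBr -mulr_conj; congr (_ - _); first by ring.
  rewrite mulrA mulr_sumr; congr (_ / _).
  by apply: eq_bigr => i' _; rewrite mulrA.
rewrite sumrB -mulr_sumr -!mulr_suml -rmorph_sum /= -slice_norm_sqr.
have := slice_minorsE a s j; move: (\sum_(i : I | _) _) => Q QE.
rewrite rmorphD rmorphM fmorphV !rmorphM /= QE !rmorphXn !rmorph_nat.
exact: polar_pairing_identity.
Qed.

End SliceInequality.

(** * The deficit in Hoelder's inequality *)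

Lemma prod_ge_1Bsum (R : realDomainType) (J : Type) (r : seq J) (x : J -> R) :
  (forall j, 0 <= x j <= 1) -> 1 - \sum_(j <- r) (1 - x j) <= \prod_(j <- r) x j.
Proof.
move=> x01; elim: r => [|j r IH]; first by rewrite !big_nil subr0.
rewrite !big_cons; have /andP[xj0 xj1] := x01 j.
have /andP[P0 P1] : 0 <= \prod_(j <- r) x j <= 1.
  apply: (big_ind (fun z => 0 <= z <= 1)) => // [|y z /andP[y0 y1] /andP[z0 z1]].
    by rewrite ler01 lexx.
  by rewrite mulr_ge0 //= mulr_ile1.
have : 0 <= (1 - x j) * (1 - \prod_(j <- r) x j) by rewrite mulr_ge0 ?subr_ge0.
rewrite mulrBl mul1r mulrBr mulr1; lra.
Qed.

(** Here v is w^q with q = 2 d / (d + 1). It is the geometric mean of the d + 1 arrays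
    w_i^2 / p_s(i_s) and prod_s p_s(i_s), whose sums are [mass s] and the product of all
    masses. If no mass exceeds 1, then Hoelder's inequality gives sum v <= 1. The square
    roots of these arrays are [dens s] and [prod_dens]. *)
Section Blei.
Variables (R : realType) (d n : nat).
Local Notation I := {ffun 'I_d -> 'I_n}.
Variables (w v : I -> R).
Hypotheses (w0 : forall i, 0 <= w i) (v0 : forall i, 0 <= v i).
Hypothesis vw : forall i, v i ^+ d.+1 = w i ^+ (2 * d).
Implicit Types (i : I) (s : 'I_d) (j : 'I_n).
Local Notation p := (slice_norm w).

Definition mass s : R := \sum_j p s j.
Definition root s j : R := Num.sqrt (p s j).
Definition dens s i : R := w i / root s (i s).
Definition prod_dens i : R := \prod_s root s (i s).

Lemma root_ge0 s j : 0 <= root s j. Proof. exact: sqrtr_ge0. Qed.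

Lemma root_sqr s j : root s j ^+ 2 = p s j.
Proof. by rewrite sqr_sqrtr ?slice_norm_ge0. Qed.

Lemma root_eq0 s j : (root s j == 0) = (p s j == 0).
Proof. by rewrite -root_sqr sqrf_eq0. Qed.

Lemma root0_w s i : root s (i s) = 0 -> w i = 0.
Proof.
move/eqP; rewrite root_eq0 => /eqP p0; apply/eqP; rewrite eq_le w0 andbT -p0.
exact: ler_slice_norm.
Qed.

Lemma dens_root s i : dens s i * root s (i s) = w i.
Proof.
have [r0|r0] := eqVneq (root s (i s)) 0; first by rewrite (root0_w r0) r0 mulr0.
by rewrite divfK.
Qed.

Lemma dens_ge0 s i : 0 <= dens s i.
Proof. by rewrite divr_ge0 ?root_ge0. Qed.

Lemma prod_dens_ge0 i : 0 <= prod_dens i.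
Proof. by apply: prodr_ge0 => s _; exact: root_ge0. Qed.

Lemma prod_dens_sqr i : prod_dens i ^+ 2 = \prod_s p s (i s).
Proof. by rewrite -prodrXl; apply: eq_bigr => s _; rewrite root_sqr. Qed.

Lemma mass_ge0 s : 0 <= mass s.
Proof. by apply: sumr_ge0 => j _; exact: slice_norm_ge0. Qed.

Lemma sum_dens s : \sum_i dens s i ^+ 2 = mass s.
Proof.
rewrite (partition_big (fun i : I => i s) xpredT) //=; apply: eq_bigr => j _.
under eq_bigr => i /eqP ij do rewrite exprMn exprVn ij root_sqr.
rewrite -mulr_suml -slice_norm_sqr expr2.
have [->|p0] := eqVneq (p s j) 0; first by rewrite mul0r mul0r.
by rewrite mulfK.
Qed.

Lemma sum_prod_dens : \sum_i prod_dens i ^+ 2 = \prod_s mass s.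
Proof.
under [LHS]eq_bigr => i _ do rewrite prod_dens_sqr.
by rewrite /mass bigA_distr_bigA.
Qed.

Lemma sum_prod_dens_marginal s (phi : 'I_n -> R) :
  \sum_i prod_dens i ^+ 2 * phi (i s)
  = (\sum_j p s j * phi j) * \prod_(t | t != s) mass t.
Proof.
pose F t j := p t j * (if t == s then phi j else 1).
have -> : \sum_i prod_dens i ^+ 2 * phi (i s) = \prod_t \sum_j F t j.
  rewrite bigA_distr_bigA; apply: eq_bigr => i _.
  rewrite prod_dens_sqr big_split /=; congr (_ * _).
  by rewrite (bigD1 s) //= eqxx big1 ?mulr1 // => t /negPf ->.
rewrite (bigD1 s) //=; congr (_ * _); first by apply: eq_bigr => j _; rewrite /F eqxx.
apply: eq_bigr => t /negPf ts.
by apply: eq_bigr => j _; rewrite /F ts mulr1.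
Qed.

(** Replacing both dens_s^2 and prod_dens^2 by dens_s * prod_dens leaves the geometric mean
    unchanged and lowers the sum by (dens_s - prod_dens)^2; then apply the inequality of
    arithmetic and geometric means. *)
Lemma agm_gap s i :
  d.+1%:R * v i + (dens s i - prod_dens i) ^+ 2
    <= \sum_t dens t i ^+ 2 + prod_dens i ^+ 2.
Proof.
have dp0 : 0 <= dens s i * prod_dens i by rewrite mulr_ge0 ?dens_ge0 ?prod_dens_ge0.
pose G t := if t == s then dens s i * prod_dens i else dens t i ^+ 2.
pose E (o : 'I_d.+1) := if unlift ord0 o is Some t then G t else dens s i * prod_dens i.
have E0 o : 0 <= E o.
  rewrite /E; case: unlift => // t; rewrite /G.
  by case: ifP => _; rewrite ?sqr_ge0.
have sumE : \sum_o E o = \sum_t dens t i ^+ 2 + prod_dens i ^+ 2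
    - (dens s i - prod_dens i) ^+ 2.
  rewrite big_ord_recl /E unlift_none (bigD1 s) //= liftK /G eqxx.
  rewrite [X in _ + (_ + X)](eq_bigr (fun t => dens t i ^+ 2)) => [|t /negPf ts].
    by rewrite [in RHS](bigD1 s) //=; ring.
  by rewrite liftK ts.
have prodE : \prod_o E o = v i ^+ d.+1.
  rewrite big_ord_recl /E unlift_none (bigD1 s) //= liftK /G eqxx.
  rewrite [X in _ * (_ * X)](eq_bigr (fun t => dens t i ^+ 2)) => [|t /negPf ts].
    have dD1 : \prod_t dens t i ^+ 2 = dens s i ^+ 2 * \prod_(t < d | t != s) dens t i ^+ 2.
      by rewrite (bigD1 s).
    rewrite mulrA mulrACA -!expr2 mulrAC -dD1.
    rewrite vw exprM -prodrXl -big_split /=.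
    under [LHS]eq_bigr => t _ do rewrite -exprMn dens_root.
    by rewrite prodr_const card_ord.
  by rewrite liftK ts.
have := (@leif_AGM R 'I_d.+1 predT E (fun o _ => E0 o)).1.
rewrite prodE card_ord sumE ler_pXn2r ?nnegrE //; last by rewrite -sumE divr_ge0 ?sumr_ge0.
by rewrite ler_pdivlMr ?ltr0Sn // mulrC; lra.
Qed.

Variable eta : R.
Hypothesis mass1 : forall s, mass s <= 1.
Hypothesis v1 : 1 - eta <= \sum_i v i.
Local Notation delta := (d.+1%:R * eta).

Lemma prod_mass_le1 : \prod_s mass s <= 1.
Proof. by apply: prodr_ile1 => s _; rewrite mass_ge0 mass1. Qed.

Lemma agm_gap_sum s :
  d.+1%:R - delta + \sum_i (dens s i - prod_dens i) ^+ 2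
    <= \sum_t mass t + \prod_t mass t.
Proof.
apply: (@le_trans _ _ (\sum_i (d.+1%:R * v i + (dens s i - prod_dens i) ^+ 2))).
  rewrite big_split /= -mulr_sumr lerD2r -{1}[d.+1%:R]mulr1 -mulrBr.
  by rewrite ler_wpM2l.
apply: le_trans (ler_sum _ (fun i _ => agm_gap s i)) _.
rewrite big_split /= sum_prod_dens exchange_big /=.
by rewrite lerD2r; apply: ler_sum => t _; rewrite sum_dens.
Qed.

(** Since all d + 1 arrays have mass at most 1, a deficit eta in Hoelder's inequality
    bounds their Hellinger distances. *)
Lemma dens_close s : \sum_i (dens s i - prod_dens i) ^+ 2 <= delta.
Proof.
have := agm_gap_sum s; have := prod_mass_le1.
have : \sum_(t < d) mass t <= d%:R.
  by apply: le_trans (ler_sum _ (fun t _ => mass1 t)) _; rewrite sumr_const card_ord.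
rewrite -natr1; lra.
Qed.

Lemma mass_ge s : 1 - delta <= mass s.
Proof.
have := agm_gap_sum s; have := prod_mass_le1.
have : 0 <= \sum_i (dens s i - prod_dens i) ^+ 2.
  by apply: sumr_ge0 => i _; exact: sqr_ge0.
have : \sum_(t < d) mass t <= d%:R - 1 + mass s.
  rewrite (bigD1 s) //= addrC lerD2r.
  apply: (@le_trans _ _ (\sum_(t < d | t != s) 1)); first by apply: ler_sum.
  rewrite sumr_const cardC1 card_ord -subn1 natrB //; exact: leq_ltn_trans (ltn_ord s).
rewrite -natr1; lra.
Qed.

Lemma prod_mass_ge : 1 - d%:R * delta <= \prod_s mass s.
Proof.
have mass01 s : 0 <= mass s <= 1 by rewrite mass_ge0 mass1.
apply: le_trans (prod_ge_1Bsum _ mass01).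
rewrite lerD2l lerN2; apply: (@le_trans _ _ (\sum_(s < d) delta)).
  by apply: ler_sum => s _; have := mass_ge s; lra.
by rewrite sumr_const card_ord -[leLHS]mulr_natl.
Qed.

End Blei.

(** * Concentration of the slice norms *)

Lemma weighted_pigeonhole (R : realDomainType) (I : finType) (c psi : I -> R) (B : R) :
  (forall i, 0 <= c i) -> 0 < \sum_i c i -> \sum_i c i * psi i <= B * \sum_i c i ->
  exists2 i, 0 < c i & psi i <= B.
Proof.
move=> c0 sc le; apply/exists2P; apply: contrapT => /forallNP none.
have big i : 0 < c i -> B < psi i.
  by move=> ci; rewrite ltNge; apply/negP => psiB; apply: (none i).
have /existsP[i0 ci0] : [exists i, 0 < c i].
  apply: contraTT sc; rewrite negb_exists => /forallP cz.
  by rewrite -leNgt; apply: sumr_le0 => i _; rewrite leNgt; exact: cz.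
have : 0 < \sum_i c i * (psi i - B).
  rewrite (bigD1 i0) //= ltr_pwDl ?mulr_gt0 ?subr_gt0 ?big //; apply: sumr_ge0 => i _.
  have [ci|ci] := ltP 0 (c i); first by rewrite mulr_ge0 // subr_ge0 ltW ?big.
  by rewrite (_ : c i = 0) ?mul0r //; apply/eqP; rewrite eq_le ci c0.
under eq_bigr => i _ do rewrite mulrBr.
by rewrite sumrB -mulr_suml mulrC subr_gt0 ltNge le.
Qed.

(** The relative distance  1 - min / max  is a metric on the nonnegative reals. *)
Section RelDist.
Variable R : realFieldType.
Implicit Types a b c : R.

Definition reldist a b := `|a - b| / Num.max a b.

Lemma reldistC a b : reldist a b = reldist b a.
Proof. by rewrite /reldist distrC maxC. Qed.

Lemma reldist_ge0 a b : 0 <= a -> 0 <= reldist a b.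
Proof. by move=> a0; rewrite divr_ge0 // le_max a0. Qed.

Lemma reldist_max a b : 0 <= a -> 0 <= b -> reldist a b * Num.max a b = `|a - b|.
Proof.
move=> a0 b0; have [m0|m0] := eqVneq (Num.max a b) 0; last by rewrite divfK.
have : Num.max a b <= 0 by rewrite m0.
rewrite ge_max => /andP[a0' b0']; rewrite m0 mulr0.
have -> : a = 0 by apply/eqP; rewrite eq_le a0' a0.
have -> : b = 0 by apply/eqP; rewrite eq_le b0' b0.
by rewrite subr0 normr0.
Qed.

Lemma reldistE a b : 0 <= a -> a < b -> reldist a b = 1 - a / b.
Proof.
move=> a0 ab; rewrite /reldist ltr0_norm ?subr_lt0 // max_r ?ltW // opprB mulrBl divff //.
by rewrite gt_eqF // (le_lt_trans a0).
Qed.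

Lemma reldist_triangle a b c : 0 <= a -> 0 <= b -> 0 <= c ->
  reldist a c <= reldist a b + reldist b c.
Proof.
move=> a0 b0 c0; wlog ac : a c a0 c0 / a <= c => [H|].
  case/orP: (le_total a c) => h; first exact: H.
  by rewrite reldistC addrC !(reldistC _ b) (reldistC b); exact: H.
move: ac; rewrite le_eqVlt => /predU1P[<-|ac].
  by rewrite /reldist subrr normr0 mul0r addr_ge0 // divr_ge0 // le_max ?a0 ?b0.
have cgt0 : 0 < c := le_lt_trans a0 ac.
rewrite (reldistE a0 ac); have [bc|cb|bc] := ltgtP b c; last first.
- by rewrite bc (reldistE a0 ac) lerDl reldist_ge0.
- have ab := lt_trans ac cb.
  rewrite (reldistE a0 ab) -[leLHS]addr0 lerD ?reldist_ge0 // lerD2l lerN2.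
  by rewrite ler_wpM2l // lef_pV2 ?posrE ?(ltW cb) // (lt_trans cgt0).
have [ab|ba] := ltP a b; last first.
  rewrite (reldistE b0 bc) -[leLHS]add0r lerD ?reldist_ge0 // lerD2l lerN2.
  by rewrite ler_wpM2r // invr_ge0 ltW.
rewrite (reldistE a0 ab) (reldistE b0 bc).
have bgt0 : 0 < b := le_lt_trans a0 ab.
have : 0 <= (b - a) * (b^-1 - c^-1).
  by rewrite mulr_ge0 ?subr_ge0 ?ltW // ltf_pV2 ?posrE.
rewrite mulrBl !mulrBr divff ?gt_eqF //; lra.
Qed.

End RelDist.

Section Pivot.
Variables (R : realType) (d n : nat).
Local Notation I := {ffun 'I_d -> 'I_n}.
Variables (w v : I -> R) (eta : R).
Hypotheses (w0 : forall i, 0 <= w i) (v0 : forall i, 0 <= v i).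
Hypothesis vw : forall i, v i ^+ d.+1 = w i ^+ (2 * d).
Hypothesis mass1 : forall s, mass w s <= 1.
Hypothesis v1 : 1 - eta <= \sum_i v i.
Hypothesis d2 : (2 <= d)%N.
Local Notation delta := (d.+1%:R * eta).
Hypothesis delta_small : d%:R * delta <= 2^-1.
Implicit Types (i k : I) (s t : 'I_d) (j : 'I_n).
Local Notation p := (slice_norm w).
Local Notation r := (root w).
Local Notation f := (dens w).
Local Notation g := (prod_dens w).
Local Notation h a b := (reldist a b ^+ 2).

Let r0 s j : 0 <= r s j := root_ge0 w s j.

(* g |r_s - r_t| is small because f_s r_s = w = f_t r_t and both f_s and f_t are close to g *)
Let gap_pointwise s t i :
  g i ^+ 2 * h (r s (i s)) (r t (i t)) <= 2 * (f s i - g i) ^+ 2 + 2 * (f t i - g i) ^+ 2.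
Proof.
set a := r s (i s); set b := r t (i t).
have a0 : 0 <= a := r0 _ _; have b0 : 0 <= b := r0 _ _; have g0 := prod_dens_ge0 w i.
apply: (@le_trans _ _ ((`|f s i - g i| + `|f t i - g i|) ^+ 2)).
  have grd0 : 0 <= g i * reldist a b := mulr_ge0 g0 (reldist_ge0 b a0).
  rewrite -exprMn lerXn2r ?nnegrE ?addr_ge0 //.
  have [m0|m0] := eqVneq (Num.max a b) 0.
    by rewrite /reldist m0 invr0 !mulr0 addr_ge0.
  have mgt0 : 0 < Num.max a b by rewrite lt_def m0 le_max a0.
  rewrite -(ler_pM2r mgt0) -mulrA reldist_max // -{1}(ger0_norm g0) -normrM.
  have -> : g i * (a - b) = b * (f t i - g i) - a * (f s i - g i).
    by have := dens_root w0 s i; have := dens_root w0 t i; rewrite -/a -/b; lra.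
  apply: le_trans (ler_normB _ _) _; rewrite !normrM !(ger0_norm a0, ger0_norm b0).
  rewrite [leRHS]mulrDl addrC ![_ * Num.max a b]mulrC lerD // ler_wpM2r // le_max lexx ?orbT //.
rewrite -[(f s i - g i) ^+ 2]real_normK ?num_real // -[(f t i - g i) ^+ 2]real_normK ?num_real //.
have := sqr_ge0 (`|f s i - g i| - `|f t i - g i|); rewrite sqrrB sqrrD; lra.
Qed.

Let same_point s t : \sum_i g i ^+ 2 * h (r s (i s)) (r t (i t)) <= 4 * delta.
Proof.
apply: le_trans (ler_sum _ (fun i _ => gap_pointwise s t i)) _.
rewrite big_split -!mulr_sumr /=.
by have := dens_close w0 v0 vw mass1 v1 s; have := dens_close w0 v0 vw mass1 v1 t; lra.
Qed.

Lemma prod_dens_mix Q i k : g (mix Q i k) * g (mix Q k i) = g i * g k.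
Proof.
rewrite /prod_dens -!big_split; apply: eq_bigr => t _ /=.
by rewrite !ffunE; case: ifP => _ //; rewrite mulrC.
Qed.

Let g1 : \sum_i g i ^+ 2 <= 1.
Proof. by rewrite sum_prod_dens; apply: prod_mass_le1. Qed.

Let g12 : 2^-1 <= \sum_i g i ^+ 2.
Proof.
rewrite sum_prod_dens; apply: le_trans (prod_mass_ge w0 v0 vw mass1 v1).
by move: delta_small; set x := _ * _ => x1; lra.
Qed.

Let delta0 : 0 <= delta.
Proof.
have [s _] : exists s : 'I_d, True by exists (Ordinal (ltnW d2)).
by apply: le_trans (dens_close w0 v0 vw mass1 v1 s); apply: sumr_ge0 => i _; exact: sqr_ge0.
Qed.

(* the measure g^2 is a product, so the coordinates s and t of one point may be taken
   from two independent points *)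
Let two_points s t : s != t ->
  \sum_i \sum_k g i ^+ 2 * g k ^+ 2 * h (r s (i s)) (r t (k t)) <= 4 * delta.
Proof.
move=> st.
have -> : \sum_i \sum_k g i ^+ 2 * g k ^+ 2 * h (r s (i s)) (r t (k t))
    = \sum_i \sum_k g i ^+ 2 * g k ^+ 2 * h (r s (i s)) (r t (i t)).
  rewrite -(sum_mix (Q := pred1 s) (P := xpredT)
    (fun i k => g i ^+ 2 * g k ^+ 2 * h (r s (i s)) (r t (i t)))) //.
  apply: eq_bigr => i _; apply: eq_bigr => k _.
  by rewrite -!exprMn prod_dens_mix !ffunE /= eqxx eq_sym (negPf st).
apply: le_trans (same_point s t); apply: ler_sum => i _.
under eq_bigr => k _ do rewrite mulrAC mulrC.
rewrite -mulr_suml ler_piMl // mulr_ge0 ?sqr_ge0 //.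
Qed.

(* for s = t go through a third coordinate *)
Let two_points_all s t :
  \sum_i \sum_k g i ^+ 2 * g k ^+ 2 * h (r s (i s)) (r t (k t)) <= 16 * delta.
Proof.
have [->{s}|st] := eqVneq s t; last first.
  by apply: le_trans (two_points st) _; rewrite ler_wpM2r ?delta0 // ler_nat.
have [u ut] : exists u, u != t.
  pose z := Ordinal (ltnW d2); pose o := Ordinal d2.
  by have [->|zt] := eqVneq t z; [exists o|exists z; rewrite eq_sym].
have tu : t != u by rewrite eq_sym.
apply: (@le_trans _ _ (2 * (\sum_i \sum_k g i ^+ 2 * g k ^+ 2 * h (r t (i t)) (r u (k u)))
   + 2 * \sum_i \sum_k g i ^+ 2 * (g k ^+ 2 * h (r u (k u)) (r t (k t))))).
  rewrite !mulr_sumr -big_split /=; apply: ler_sum => i _.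
  rewrite !mulr_sumr -big_split /=; apply: ler_sum => k _.
  set c := g i ^+ 2; set c' := g k ^+ 2.
  have cc : 0 <= c * c' by rewrite mulr_ge0 ?sqr_ge0.
  have -> : 2 * (c * c' * h (r t (i t)) (r u (k u))) + 2 * (c * (c' * h (r u (k u)) (r t (k t))))
     = c * c' * (2 * h (r t (i t)) (r u (k u)) + 2 * h (r u (k u)) (r t (k t))) by ring.
  apply: ler_wpM2l => //.
  have tri := reldist_triangle (r0 t (i t)) (r0 u (k u)) (r0 t (k t)).
  apply: (@le_trans _ _ ((reldist (r t (i t)) (r u (k u)) + reldist (r u (k u)) (r t (k t))) ^+ 2)).
    by rewrite lerXn2r ?nnegrE ?addr_ge0 ?reldist_ge0 ?r0.
  have := sqr_ge0 (reldist (r t (i t)) (r u (k u)) - reldist (r u (k u)) (r t (k t))).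
  rewrite sqrrB sqrrD; lra.
have t1 := two_points tu.
have t2 : \sum_i \sum_k g i ^+ 2 * (g k ^+ 2 * h (r u (k u)) (r t (k t))) <= 4 * delta.
  under eq_bigr => i _ do rewrite -mulr_sumr.
  rewrite -mulr_suml; apply: le_trans (same_point u t).
  by apply: ler_piMl => //; apply: sumr_ge0 => k _; rewrite mulr_ge0 ?sqr_ge0.
move: t1 t2; set D := _ * eta; lra.
Qed.

Let marginal s (phi : 'I_n -> R) : (forall j, 0 <= phi j) ->
  \sum_j p s j * phi j <= 2 * \sum_i g i ^+ 2 * phi (i s).
Proof.
move=> phi0; rewrite sum_prod_dens_marginal.
set S := \sum_j _; set M := \prod_(t | _) _.
have S0 : 0 <= S by apply: sumr_ge0 => j _; rewrite mulr_ge0 ?slice_norm_ge0.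
have M12 : 2^-1 <= M.
  apply: le_trans g12 _; rewrite sum_prod_dens (bigD1 s) //= ler_piMl //.
  by apply: prodr_ge0 => t _; exact: mass_ge0.
have : 0 <= S * (M - 2^-1) by rewrite mulr_ge0 ?subr_ge0.
rewrite mulrBr; lra.
Qed.

(** All slice norms, at every coordinate, concentrate near a single value c^2: any two of
    them, at independent random places, are close, so one may be fixed. *)
Lemma exists_pivot : exists2 c, 0 < c &
  forall s, \sum_j p s j * reldist (r s j) c ^+ 2 <= 64 * d%:R * delta.
Proof.
pose z : 'I_d := Ordinal (ltnW d2).
pose psi k := \sum_s \sum_i g i ^+ 2 * h (r s (i s)) (r z (k z)).
have gsum0 : 0 < \sum_k g k ^+ 2 by apply: lt_le_trans g12; rewrite invr_gt0.
have [|k ck psik] := @weighted_pigeonhole R I (fun k => g k ^+ 2) psi (32 * d%:R * delta)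
   (fun k => sqr_ge0 _) gsum0.
  apply: (@le_trans _ _ (\sum_(s < d) 16 * delta)).
    rewrite /psi; under eq_bigr => k _ do rewrite mulr_sumr.
    rewrite exchange_big /=; apply: ler_sum => s _.
    apply: le_trans (two_points_all s z); rewrite exchange_big /=.
    rewrite le_eqVlt; apply/orP; left; apply/eqP.
    apply: eq_bigr => k _; rewrite mulr_sumr; apply: eq_bigr => i _; ring.
  rewrite sumr_const card_ord -[leLHS]mulr_natl.
  have : 0 <= d%:R * delta * (\sum_k g k ^+ 2 - 2^-1).
    by rewrite mulr_ge0 ?subr_ge0 // mulr_ge0 ?delta0.
  rewrite mulrBr; move: (\sum_k _) => G; set D := _ * eta; lra.
exists (r z (k z)).
  rewrite lt_def r0 andbT; apply: contraTneq ck => rk0.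
  by rewrite prod_dens_sqr (bigD1 z) //= -root_sqr rk0 expr0n mul0r ltxx.
move=> s; have /(marginal s) : forall j, 0 <= h (r s j) (r z (k z)) by move=> j; exact: sqr_ge0.
move=> /le_trans; apply.
have : \sum_i g i ^+ 2 * h (r s (i s)) (r z (k z)) <= psi k.
  rewrite /psi [leRHS](bigD1 s) //= lerDl; apply: sumr_ge0 => t _.
  by apply: sumr_ge0 => i _; rewrite mulr_ge0 ?sqr_ge0.
move: psik; set D := _ * eta; lra.
Qed.

End Pivot.

(** * Sums over boxes *)

Section FiniteVariance.
Variables (R : realFieldType) (J : finType) (A : {set J}) (x : J -> R).
Local Notation m := (#|A|%:R : R).

Lemma sqr_sum_le : (\sum_(j in A) x j) ^+ 2 <= m * \sum_(j in A) x j ^+ 2.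
Proof.
have e1 : \sum_(j in A) (1 : R) ^+ 2 = m by rewrite sumr_const expr1n.
have := cauchy_schwarz_sum (mem A) (fun=> 1) x; rewrite e1.
by under eq_bigr => j _ do rewrite mul1r.
Qed.

(* the variance is at most the mean square deviation from any constant *)
Lemma sqr_sum_ge c :
  m * \sum_(j in A) x j ^+ 2
    <= (\sum_(j in A) x j) ^+ 2 + m * \sum_(j in A) (x j - c) ^+ 2.
Proof.
have -> : \sum_(j in A) (x j - c) ^+ 2
    = \sum_(j in A) x j ^+ 2 - 2 * c * \sum_(j in A) x j + m * c ^+ 2.
  rewrite [m * c ^+ 2]mulr_natl -sumr_const mulr_sumr -sumrB -big_split /=.
  by apply: eq_bigr => j _; ring.
have := sqr_ge0 (\sum_(j in A) x j - m * c); lra.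
Qed.

End FiniteVariance.

Lemma exists_subset_card (J : finType) (A : {set J}) m :
  (m <= #|A|)%N -> exists2 B : {set J}, B \subset A & #|B| = m.
Proof.
move=> mA; exists [set j in take m (enum A)].
  by apply/fintype.subsetP => j; rewrite inE => /mem_take; rewrite mem_enum.
rewrite cardsE (card_uniqP _) ?take_uniq ?enum_uniq // size_take -cardE.
by case: ltngtP mA.
Qed.

Section Box.
Variables (R : realType) (d n : nat).
Local Notation I := {ffun 'I_d -> 'I_n}.

Lemma mem_box (J : 'I_d -> {set 'I_n}) (i : I) :
  (i \in box J) = [forall s, i s \in J s].
Proof. by rewrite inE. Qed.

Lemma sum_box_prod (J : 'I_d -> {set 'I_n}) (F : 'I_d -> 'I_n -> R) :
  \sum_(i in box J) \prod_s F s (i s) = \prod_s \sum_(j in J s) F s j.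
Proof.
rewrite bigA_distr_big_dep /=; apply: eq_bigl => i.
by rewrite mem_box; apply/forallP/familyP.
Qed.

Lemma sum_box_coord (J : 'I_d -> {set 'I_n}) (m : nat) (s : 'I_d) (F : 'I_n -> R) :
  (forall s, #|J s| = m) ->
  \sum_(i in box J) F (i s) = m%:R ^+ d.-1 * \sum_(j in J s) F j.
Proof.
move=> Jm; pose G (t : 'I_d) j := if t == s then F j else 1.
have -> : \sum_(i in box J) F (i s) = \sum_(i in box J) \prod_t G t (i t).
  apply: eq_bigr => i _; rewrite (bigD1 s) //= /G eqxx big1 ?mulr1 // => t /negPf ->.
  by [].
rewrite sum_box_prod (bigD1 s) //= mulrC; congr (_ * _).
  rewrite (eq_bigr (fun=> m%:R)) => [|t /negPf ts].
    by rewrite prodr_const cardC1 card_ord.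
  by rewrite /G ts sumr_const Jm.
by apply: eq_bigr => j _; rewrite /G eqxx.
Qed.

Lemma card_box (J : 'I_d -> {set 'I_n}) (m : nat) :
  (forall s, #|J s| = m) -> \sum_(i in box J) (1 : R) = m%:R ^+ d.
Proof.
move=> Jm; have -> : \sum_(i in box J) (1 : R) = \sum_(i in box J) \prod_(s < d) 1.
  by apply: eq_bigr => i _; rewrite big1_eq.
rewrite (sum_box_prod J (fun _ _ => 1)) (eq_bigr (fun=> m%:R)) => [|s _].
  by rewrite prodr_const card_ord.
by rewrite sumr_const Jm.
Qed.

End Box.

(** * The cores and their sizes *)

Section Sizes.
Variables (R : realType) (d n : nat).
Local Notation I := {ffun 'I_d -> 'I_n}.
Variables (w v : I -> R) (eta : R).
Hypotheses (w0 : forall i, 0 <= w i) (v0 : forall i, 0 <= v i).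
Hypothesis vw : forall i, v i ^+ d.+1 = w i ^+ (2 * d).
Hypothesis mass1 : forall s, mass w s <= 1.
Hypothesis v1 : 1 - eta <= \sum_i v i.
Implicit Types (i k : I) (s t : 'I_d) (j : 'I_n) (J : 'I_d -> {set 'I_n}).
Local Notation p := (slice_norm w).
Local Notation r := (root w).
Local Notation f := (dens w).
Local Notation g := (prod_dens w).
Local Notation delta := (d.+1%:R * eta).
Local Notation D := (d%:R : R).

Lemma prod_dens_tail J :
  \sum_(i | i \notin box J) g i ^+ 2 <= \sum_s \sum_(j | j \notin J s) p s j.
Proof.
apply: (@le_trans _ _ (\sum_s \sum_i g i ^+ 2 * (i s \notin J s)%:R)).
  rewrite exchange_big /= [leRHS](bigID (mem (box J))) /= -[leLHS]add0r.
  apply: lerD.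
    by do 2!apply: sumr_ge0 => ? _; rewrite mulr_ge0 ?sqr_ge0 ?ler0n.
  apply: ler_sum => i; rewrite mem_box negb_forall => /existsP[s sJ].
  rewrite (bigD1 s) //= sJ mulr1 lerDl.
  by apply: sumr_ge0 => t _; rewrite mulr_ge0 ?sqr_ge0 ?ler0n.
apply: ler_sum => s _; rewrite (sum_prod_dens_marginal _ _ (fun j => (j \notin J s)%:R)).
rewrite [X in _ <= X]big_mkcond /=.
have -> : \sum_j p s j * (j \notin J s)%:R = \sum_j if j \notin J s then p s j else 0.
  by apply: eq_bigr => j _; case: ifP; rewrite ?mulr1 ?mulr0.
rewrite ler_piMr //.
  by apply: sumr_ge0 => j _; case: ifP => // _; exact: slice_norm_ge0.
by apply: prodr_ile1 => t _; rewrite mass_ge0 mass1.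
Qed.

(** Outside a box, v is at most the mean of the d + 1 arrays, all of which are close to the
    product array, whose tail is bounded by the tails of its marginals. *)
Lemma tail_le J (s0 : 'I_d) :
  \sum_(i | i \notin box J) v i
    <= 2 * \sum_s \sum_(j | j \notin J s) p s j + 2 * delta.
Proof.
have delta0 : 0 <= delta.
  by apply: le_trans (dens_close w0 v0 vw mass1 v1 s0); apply: sumr_ge0 => i _; exact: sqr_ge0.
have pw i : d.+1%:R * v i <= (2 * D + 1) * g i ^+ 2 + 2 * \sum_s (f s i - g i) ^+ 2.
  have := agm_gap w0 v0 vw s0 i; have := sqr_ge0 (f s0 i - g i).
  have : \sum_t f t i ^+ 2 <= \sum_(t < d) (2 * g i ^+ 2 + 2 * (f t i - g i) ^+ 2).
    apply: ler_sum => t _; rewrite -subr_ge0.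
    rewrite (_ : _ - _ = (f t i - 2 * g i) ^+ 2) ?sqr_ge0 //; ring.
  rewrite big_split /= -!mulr_sumr sumr_const card_ord -[_ *+ d]mulr_natl.
  set A := \sum_t _; set B := \sum_t _; lra.
have : d.+1%:R * \sum_(i | i \notin box J) v i
    <= (2 * D + 1) * \sum_(i | i \notin box J) g i ^+ 2 + 2 * (D * delta).
  rewrite !mulr_sumr; apply: le_trans (ler_sum _ (fun i _ => pw i)) _.
  rewrite big_split /= lerD2l -mulr_sumr ler_wpM2l //.
  rewrite exchange_big /=; apply: (@le_trans _ _ (\sum_(s < d) delta)).
    apply: ler_sum => s _; apply: le_trans (dens_close w0 v0 vw mass1 v1 s).
    rewrite [leRHS](bigID (fun i => i \notin box J)) /= lerDl.
    by apply: sumr_ge0 => i _; exact: sqr_ge0.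
  by rewrite sumr_const card_ord -[leLHS]mulr_natl.
have := prod_dens_tail J.
have : 0 <= \sum_(i | i \notin box J) g i ^+ 2 by apply: sumr_ge0 => i _; exact: sqr_ge0.
set M := \sum_(i | _) g i ^+ 2; set V := \sum_(i | _) v i.
set Q := \sum_(s < d) _ => M0 MQ le.
have d1 : 0 < d.+1%:R :> R by rewrite ltr0Sn.
rewrite -(ler_pM2l d1); apply: le_trans le _.
apply: (@le_trans _ _ (d.+1%:R * (2 * M + 2 * delta))); last first.
  apply: ler_wpM2l; first exact: ltW.
  by rewrite lerD2r; apply: ler_wpM2l.
have : 0 <= delta by []. 
rewrite -natr1; have D0 : 0 <= D by []. 
set e := (D + 1) * eta => e0; lra.
Qed.

Variable c : R.
Hypothesis c0 : 0 < c.
Variable kappa : R.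
Hypothesis pivot : forall s, \sum_j p s j * reldist (r s j) c ^+ 2 <= kappa.

(* the values j at s whose slice norm is within a factor 4 of c^2 *)
Definition core s : {set 'I_n} := [set j | reldist (r s j) c <= 2^-1].

Let r0 s j : 0 <= r s j := root_ge0 w s j.

Lemma core_bounds s j : j \in core s -> c / 2 <= r s j <= 2 * c.
Proof.
rewrite inE; have [rc|cr|->] := ltgtP (r s j) c.
- rewrite reldistE // => h; have : 2^-1 <= r s j / c by lra.
  rewrite ler_pdivlMr // => h'; apply/andP; split; lra.
- rewrite reldistC reldistE ?(ltW c0) // => h.
  have : 2^-1 <= c / r s j by lra.
  rewrite ler_pdivlMr ?(lt_trans c0) // => h'; apply/andP; split; lra.
- by move=> _; apply/andP; split; have := c0; lra.
Qed.

Lemma core_complement s : \sum_(j | j \notin core s) p s j <= 4 * kappa.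
Proof.
apply: (@le_trans _ _ (4 * \sum_j p s j * reldist (r s j) c ^+ 2)); last first.
  by rewrite ler_wpM2l.
rewrite mulr_sumr [leRHS](bigID (fun j => j \notin core s)) /= -[leLHS]addr0.
have t0 j : 0 <= 4 * (p s j * reldist (r s j) c ^+ 2).
  by rewrite mulr_ge0 // mulr_ge0 ?slice_norm_ge0 ?sqr_ge0.
apply: lerD; last by apply: sumr_ge0.
apply: ler_sum => j; rewrite inE -ltNge => lt.
rewrite mulrCA ler_peMr ?slice_norm_ge0 //.
have : 2^-1 ^+ 2 <= reldist (r s j) c ^+ 2.
  by rewrite lerXn2r ?nnegrE ?reldist_ge0 ?invr_ge0 // ltW.
by rewrite exprVn; lra.
Qed.

Lemma core_variance s : \sum_(j in core s) (r s j - c) ^+ 2 <= 16 * kappa.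
Proof.
apply: (@le_trans _ _ (16 * \sum_j p s j * reldist (r s j) c ^+ 2)); last first.
  by rewrite ler_wpM2l.
rewrite mulr_sumr [leRHS](bigID (mem (core s))) /= -[leLHS]addr0.
have t0 j : 0 <= 16 * (p s j * reldist (r s j) c ^+ 2).
  by rewrite mulr_ge0 // mulr_ge0 ?slice_norm_ge0 ?sqr_ge0.
apply: lerD; last by apply: sumr_ge0.
apply: ler_sum => j /core_bounds /andP[lo hi].
rewrite -real_normK ?num_real // -(reldist_max (r0 s j) (ltW c0)) exprMn.
rewrite [leRHS]mulrA [leRHS]mulrC ler_wpM2l ?sqr_ge0 //.
have -> : 16 * p s j = (4 * r s j) ^+ 2 by rewrite exprMn root_sqr; ring.
rewrite lerXn2r ?nnegrE ?mulr_ge0 ?r0 ?le_max ?(r0 s j) // ge_max; apply/andP; split.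
  by have := r0 s j; lra.
by have := c0; lra.
Qed.

Let pivot_le s : \sum_(j in core s) p s j <= 1.
Proof.
apply: le_trans (mass1 s); rewrite /mass [leRHS](bigID (mem (core s))) /= lerDl.
by apply: sumr_ge0 => j _; exact: slice_norm_ge0.
Qed.

Lemma core_card_le s : #|core s|%:R * c ^+ 2 <= 4.
Proof.
have : \sum_(j in core s) (c / 2) ^+ 2 <= \sum_(j in core s) p s j.
  apply: ler_sum => j /core_bounds /andP[lo _].
  by rewrite -root_sqr lerXn2r ?nnegrE ?divr_ge0 ?(ltW c0).
rewrite sumr_const -[_ *+ _]mulr_natl expr_div_n; have := pivot_le s; lra.
Qed.

Local Notation core_sqr := (\sum_(i in box core) w i ^+ 2).

(** The sum of w^2 over the box does not depend on the coordinate s by which it is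
    sliced. On the core at s all slice norms are nearly c^2, so the sum of their squares
    nearly equals its Cauchy-Schwarz lower bound (sum p_s)^2 / #|core s|, which is at most
    1 / #|core s|. *)
Lemma core_card_upper s : #|core s|%:R * core_sqr <= 1 + 576 * kappa.
Proof.
have wp : core_sqr <= \sum_(j in core s) p s j ^+ 2.
  rewrite (partition_big (fun i : I => i s) (mem (core s))) /=; last first.
    by move=> i; rewrite mem_box => /forallP.
  apply: ler_sum => j _; rewrite slice_norm_sqr.
  rewrite [leRHS](bigID (fun i => i \in box core)) /=.
  rewrite (eq_bigl (fun i : I => (i s == j) && (i \in box core))) ?lerDl.
    by apply: sumr_ge0 => i _; exact: sqr_ge0.
  by move=> i; rewrite andbC.
apply: (@le_trans _ _ (#|core s|%:R * \sum_(j in core s) p s j ^+ 2)).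
  by rewrite ler_wpM2l.
apply: le_trans (sqr_sum_ge _ _ (c ^+ 2)) _; apply: lerD.
  by rewrite -[leRHS](expr1n R 2) lerXn2r ?nnegrE ?sumr_ge0 // => j _; exact: slice_norm_ge0.
apply: (@le_trans _ _ (#|core s|%:R * (9 * c ^+ 2 * (16 * kappa)))).
  rewrite ler_wpM2l //; apply: (@le_trans _ _ (9 * c ^+ 2 * \sum_(j in core s) (r s j - c) ^+ 2)).
    rewrite mulr_sumr; apply: ler_sum => j /core_bounds /andP[lo hi].
    rewrite -root_sqr subr_sqr exprMn mulrC ler_wpM2r ?sqr_ge0 //.
    have -> : 9 * c ^+ 2 = (3 * c) ^+ 2 by ring.
    rewrite lerXn2r ?nnegrE //; have := r0 s j; have := c0; lra.
  by rewrite ler_wpM2l ?core_variance // mulr_ge0 ?sqr_ge0.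
have kappa0 : 0 <= kappa.
  apply: le_trans (pivot s); apply: sumr_ge0 => j _.
  by rewrite mulr_ge0 ?slice_norm_ge0 ?sqr_ge0.
have : 0 <= kappa * (4 - #|core s|%:R * c ^+ 2).
  by rewrite mulr_ge0 // subr_ge0 core_card_le.
lra.
Qed.

(** The truncation of w to the box of the cores is still nearly extremal, so its mass at s
    is nearly 1; by Cauchy-Schwarz this mass squared is at most the right-hand side. *)
Lemma core_card_lower s (eta' : R) :
  1 - eta' <= \sum_(i in box core) v i -> d.+1%:R * eta' <= 1 ->
  1 - 2 * (d.+1%:R * eta') <= #|core s|%:R * core_sqr.
Proof.
move=> v1' small; pose w' i := if i \in box core then w i else 0.
pose v' i := if i \in box core then v i else 0.
have w'0 i : 0 <= w' i by rewrite /w'; case: ifP.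
have v'0 i : 0 <= v' i by rewrite /v'; case: ifP.
have vw' i : v' i ^+ d.+1 = w' i ^+ (2 * d).
  rewrite /v' /w'; case: ifP => // _; rewrite expr0n expr0n /=.
  by rewrite muln_eq0 /=; case: (d) s => [[]|].
have w'w t j : slice_norm w' t j <= p t j.
  apply: ler_wsqrtr; apply: ler_sum => i _; rewrite /w'; case: ifP => // _.
  by rewrite expr0n sqr_ge0.
have mass1' t : mass w' t <= 1.
  by apply: le_trans (mass1 t); apply: ler_sum.
have v1'' : 1 - eta' <= \sum_i v' i by rewrite /v' -big_mkcond.
have := mass_ge w'0 v'0 vw' mass1' v1'' s.
have -> : mass w' s = \sum_(j in core s) slice_norm w' s j.
  rewrite [RHS]big_mkcond /=; apply: eq_bigr => j _; case: ifPn => // js.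
  apply/eqP; rewrite sqrtr_eq0 big1 // => i /eqP ij; rewrite /w' ifF ?expr0n //.
  by apply/negbTE; rewrite mem_box; apply: contra js => /forallP/(_ s); rewrite ij.
move=> le; have := @sqr_sum_le R _ (core s) (slice_norm w' s).
have -> : \sum_(j in core s) slice_norm w' s j ^+ 2 = core_sqr.
  rewrite (partition_big (fun i : I => i s) (mem (core s))) /=; last first.
    by move=> i; rewrite mem_box => /forallP.
  apply: eq_bigr => j _; rewrite slice_norm_sqr (bigID (fun i => i \in box core)) /=.
  rewrite [X in _ + X]big1 ?addr0 => [|i /andP[_ /negPf ib]]; last first.
    by rewrite /w' ib expr0n.
  apply: eq_big => [i|i /andP[_ ib]]; first by rewrite andbC.
  by rewrite /w' ib.
apply: le_trans.
apply: (@le_trans _ _ ((1 - d.+1%:R * eta') ^+ 2)).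
  rewrite sqrrB expr1n; have := sqr_ge0 (d.+1%:R * eta'); lra.
by rewrite lerXn2r ?nnegrE ?subr_ge0 // (le_trans _ le) ?subr_ge0.
Qed.

End Sizes.

(** * Stability of the moduli *)

(** In units of the deficit eta, these bound: the mean square relative distance of the
    roots of the slice norms to the pivot; the deficit in the lower bound for the sizes of
    the cores; the mass lost by trimming the cores
    to a common size; the loss in the sums of the roots of the slice norms; the sum of v
    outside the box; and the squared l2 error of w inside it, in units of 1 / m. *)
Section StabilityConstants.
Variables (R : realType) (d : nat).
Local Notation D := (d%:R : R).
Definition pivot_const : R := 64 * D * (D + 1).
Definition size_const : R := 2 * (D + 1) * (1 + 8 * D * pivot_const + 2 * (D + 1)).
Definition trim_const : R := 32 * (576 * pivot_const + size_const).
Definition root_const : R := D + 1 + 20 * pivot_const + trim_const.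
Definition tail_const : R := 2 * D * (4 * pivot_const + trim_const) + 2 * (D + 1).
Definition core_const : R := 64 * (D + 1 + 2 * D * root_const) + 4 * root_const.

Let D0 : 0 <= D. Proof. exact: ler0n. Qed.
Let D10 : 0 <= D + 1. Proof. exact: addr_ge0. Qed.

Lemma pivot_const_ge0 : 0 <= pivot_const.
Proof. by rewrite mulr_ge0 // mulr_ge0. Qed.

Lemma size_const_ge0 : 0 <= size_const.
Proof.
apply: mulr_ge0; first exact: mulr_ge0.
by have := mulr_ge0 D0 pivot_const_ge0; have := D10; lra.
Qed.

Lemma trim_const_ge0 : 0 <= trim_const.
Proof. by rewrite /trim_const; have := pivot_const_ge0; have := size_const_ge0; lra. Qed.

Lemma root_const_ge0 : 0 <= root_const.
Proof.
by rewrite /root_const; have := pivot_const_ge0; have := trim_const_ge0; have := D10; lra.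
Qed.

Lemma tail_const_ge0 : 0 <= tail_const.
Proof.
rewrite /tail_const; have := mulr_ge0 D0 pivot_const_ge0.
by have := mulr_ge0 D0 trim_const_ge0; have := D10; lra.
Qed.

Lemma core_const_ge0 : 0 <= core_const.
Proof.
rewrite /core_const; have := mulr_ge0 D0 root_const_ge0.
by have := root_const_ge0; have := D10; lra.
Qed.

End StabilityConstants.

Section ModulusStability.
Variables (R : realType) (d n : nat).
Local Notation I := {ffun 'I_d -> 'I_n}.
Variables (w v : I -> R) (eta : R).
Hypotheses (w0 : forall i, 0 <= w i) (v0 : forall i, 0 <= v i).
Hypothesis vw : forall i, v i ^+ d.+1 = w i ^+ (2 * d).
Hypothesis mass1 : forall s, mass w s <= 1.
Hypothesis v1 : 1 - eta <= \sum_i v i.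
Hypothesis d2 : (2 <= d)%N.
Hypothesis eta0 : 0 <= eta.
Hypothesis eta_small : size_const R d * eta <= 2^-1.
Implicit Types (i k : I) (s t : 'I_d) (j : 'I_n) (J : 'I_d -> {set 'I_n}).
Local Notation p := (slice_norm w).
Local Notation r := (root w).
Local Notation f := (dens w).
Local Notation g := (prod_dens w).
Local Notation delta := (d.+1%:R * eta).
Local Notation D := (d%:R : R).
Local Notation kappa := (pivot_const R d * eta).
Local Notation theta := (size_const R d * eta).
Local Notation lambda := (trim_const R d * eta).
Local Notation rho := (root_const R d * eta).
Local Notation u m := ((Num.sqrt (m%:R : R))^-1).

Let D0 : 0 <= D. Proof. exact: ler0n. Qed.
Let pivot0 : 0 <= pivot_const R d := pivot_const_ge0 R d.
Let size0 : 0 <= size_const R d := size_const_ge0 R d.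
Let kappa0 : 0 <= kappa. Proof. exact: mulr_ge0. Qed.
Let theta0 : 0 <= theta. Proof. exact: mulr_ge0. Qed.

Let delta_small : D * delta <= 2^-1.
Proof.
apply: le_trans eta_small; rewrite mulrA ler_wpM2r // /size_const -[d.+1%:R]natr1.
have := D0; have := mulr_ge0 D0 D0.
have : 0 <= (D + 1) * (D * pivot_const R d) by rewrite !(mulr_ge0, addr_ge0).
set P := pivot_const R d; lra.
Qed.

(** The sizes of the cores agree up to a factor 1 + O(eta), although their elements are
    only known to have slice norms within a factor 1 + O(sqrt eta) of each other in mean
    square. Hence trimming all cores to the smallest size costs only O(eta) of the mass. *)
Lemma exists_trimmed_cores : exists m (J : 'I_d -> {set 'I_n}) (c : R),
  [/\ (0 < m)%N, 0 < c /\ m%:R * c ^+ 2 <= 4, forall s, #|J s| = m,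
      forall s, \sum_(j | j \notin J s) p s j <= 4 * kappa + lambda &
      forall s, (forall j, j \in J s -> r s j <= 2 * c) /\
         \sum_(j in J s) (r s j - c) ^+ 2 <= 16 * kappa].
Proof.
have [c c0 pivot'] := exists_pivot w0 v0 vw mass1 v1 d2 delta_small.
have pivot s : \sum_j p s j * reldist (r s j) c ^+ 2 <= kappa.
  by apply: le_trans (pivot' s) _; rewrite /pivot_const -[d.+1%:R]natr1 [leLHS]mulrA.
pose G := core w c; pose s0 : 'I_d := Ordinal (ltnW d2).
pose S := \sum_(i in box G) w i ^+ 2.
have upper s : #|G s|%:R * S <= 1 + 576 * kappa := core_card_upper mass1 c0 pivot s.
have lower s : 1 - theta <= #|G s|%:R * S.
  (* the deficit after truncation to the box of the cores *)
  pose eta' := (1 + 8 * D * pivot_const R d + 2 * (D + 1)) * eta.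
  have thetaE : theta = 2 * (d.+1%:R * eta') by rewrite /eta' /size_const -[d.+1%:R]natr1; ring.
  rewrite thetaE; apply: (core_card_lower (v := v)) => //; last first.
    by have := eta_small; rewrite thetaE; set x := _ * eta'; lra.
  have := tail_le w0 v0 vw mass1 v1 G s0.
  have : \sum_s \sum_(j | j \notin G s) p s j <= D * (4 * kappa).
    apply: (@le_trans _ _ (\sum_(s < d) 4 * kappa)).
      by apply: ler_sum => t _; exact: core_complement.
    by rewrite sumr_const card_ord -[leLHS]mulr_natl.
  have := v1; rewrite (bigID (fun i => i \in box G)) /=.
  rewrite /eta' -[d.+1%:R]natr1; set X := \sum_(i in box G) v i.
  set Y := \sum_(i | _) v i; set Z := \sum_(s < d) _; lra.
have [sm _ smin] : exists2 sm : 'I_d, true & forall s, (#|G sm| <= #|G s|)%N.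
  case: (@arg_minnP _ s0 xpredT (fun s => #|G s|)) => // sm _ smin.
  by exists sm => // s; exact: smin.
pose m := #|G sm|.
have mS : 2^-1 <= m%:R * S by apply: le_trans (lower sm); have := eta_small; lra.
have S0 : 0 < S.
  have : 0 <= S by apply: sumr_ge0 => i _; exact: sqr_ge0.
  rewrite le_eqVlt => /predU1P[SE|//].
  by move: mS; rewrite -SE mulr0 leNgt invr_gt0 ltr0n.
have m0 : (0 < m)%N.
  by rewrite lt0n; apply: contraTneq mS => ->; rewrite mul0r -ltNge invr_gt0 ltr0n.
have /choice[J JP] : forall s, exists B : {set 'I_n}, B \subset G s /\ #|B| = m.
  by move=> s; have [B ? ?] := exists_subset_card (smin s); exists B.
have JG s j : j \in J s -> j \in G s by have [/fintype.subsetP + _] := JP s; apply.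
have mc : m%:R * c ^+ 2 <= 4 by apply: core_card_le.
exists m, J, c; split=> // [s|s|s]; first by case: (JP s).
  have -> : \sum_(j | j \notin J s) p s j
      = \sum_(j | j \notin G s) p s j + \sum_(j in G s :\: J s) p s j.
    rewrite (bigID (fun j => j \notin G s)) /=; congr (_ + _); apply: eq_bigl => j.
      by rewrite andbC; case: (boolP (j \in G s)) => // jG; apply: contra jG; exact: JG.
    by rewrite !inE negbK.
  apply: lerD; first exact: core_complement.
  apply: (@le_trans _ _ (\sum_(j in G s :\: J s) 4 * c ^+ 2)).
    apply: ler_sum => j; rewrite inE => /andP[_ /(core_bounds c0)/andP[_ hi]].
    rewrite -root_sqr (_ : 4 * c ^+ 2 = (2 * c) ^+ 2); last by ring.
    by rewrite lerXn2r ?nnegrE ?root_ge0 // mulr_ge0 // ltW.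
  rewrite sumr_const cardsD (finset.setIidPr (JP s).1) (JP s).2 -[leLHS]mulr_natl natrB ?smin //.
  have tk0 : 0 <= 576 * kappa + theta by have := kappa0; have := theta0; lra.
  have diff : #|G s|%:R - m%:R <= 2 * (576 * kappa + theta) * m%:R.
    rewrite -(ler_pM2r S0).
    have : 0 <= (576 * kappa + theta) * (2 * (m%:R * S) - 1).
      by apply: mulr_ge0 => //; have := mS; lra.
    have := upper s; have := lower sm; rewrite -/m; lra.
  apply: (@le_trans _ _ (2 * (576 * kappa + theta) * m%:R * (4 * c ^+ 2))).
    by rewrite ler_wpM2r // mulr_ge0 ?sqr_ge0.
  have -> : 2 * (576 * kappa + theta) * m%:R * (4 * c ^+ 2)
      = 8 * (576 * kappa + theta) * (m%:R * c ^+ 2) by ring.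
  have -> : lambda = 8 * (576 * kappa + theta) * 4 by rewrite /trim_const; ring.
  by apply: ler_wpM2l; [move: tk0; lra|exact: mc].
split=> [j /JG/(core_bounds c0)/andP[]//|].
apply: le_trans (core_variance c0 pivot s).
rewrite [leRHS](bigID (mem (J s))) /= -[leLHS]addr0; apply: lerD; last first.
  by apply: sumr_ge0 => j _; exact: sqr_ge0.
rewrite le_eqVlt (eq_bigl (fun j => (j \in G s) && (j \in J s))) ?eqxx // => j.
by case: (boolP (j \in J s)) => [/JG ->|]; rewrite ?andbF.
Qed.

Lemma invsqrt_sqr (m : nat) : (0 < m)%N -> u m ^+ 2 * m%:R = 1.
Proof. by move=> m0; rewrite exprVn sqr_sqrtr // mulVf // pnatr_eq0 -lt0n. Qed.

(** On J_s the vector r_s has norm at most 1, and its inner product with the constant unit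
    vector 1 / sqrt m is at least 1 - O(eta). Inner products of tensor products multiply, so
    the squared l2 distance of prod_dens to m^(-d/2) on the box is O(eta) as well. The
    moduli w = f_s r_s are then compared with m^(-d/2) m^(-1/2). *)
Lemma modulus_stability : exists m (J : 'I_d -> {set 'I_n}),
  [/\ (0 < m)%N, forall s, #|J s| = m,
      \sum_(i | i \notin box J) v i <= tail_const R d * eta,
      \sum_(i in box J) (w i - u m ^+ d.+1) ^+ 2 <= core_const R d * eta * u m ^+ 2 &
      forall s j, j \in J s -> p s j <= 16 * u m ^+ 2].
Proof.
have [m [J [c [m0 [c0 mc] Jm Jtail Jcore]]]] := exists_trimmed_cores.
pose s0 : 'I_d := Ordinal (ltnW d2).
set um := u m; have um1 : um ^+ 2 * m%:R = 1 := invsqrt_sqr m0.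
have um0 : 0 <= um by rewrite invr_ge0 sqrtr_ge0.
have mgt0 : 0 < m%:R :> R by rewrite ltr0n.
have c16 : 4 * c ^+ 2 <= 16 * um ^+ 2.
  by rewrite -(ler_pM2r mgt0) -[leRHS]mulrA um1 -[leLHS]mulrA [c ^+ 2 * _]mulrC; lra.
have pJ s j : j \in J s -> p s j <= 16 * um ^+ 2.
  move=> js; apply: le_trans c16; rewrite -root_sqr.
  rewrite (_ : 4 * c ^+ 2 = (2 * c) ^+ 2); last by ring.
  by rewrite lerXn2r ?nnegrE ?root_ge0 ?mulr_ge0 ?(ltW c0) // (Jcore s).1.
have massJ s : \sum_(j in J s) p s j <= 1.
  apply: le_trans (mass1 s); rewrite /mass [leRHS](bigID (mem (J s))) /= lerDl.
  by apply: sumr_ge0 => j _; exact: slice_norm_ge0.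
(* the inner product of r_s with the normalized indicator of J_s *)
pose A s := um * \sum_(j in J s) r s j.
have A0 s : 0 <= A s by rewrite mulr_ge0 // sumr_ge0 // => j _; exact: root_ge0.
have sum_r s : \sum_(j in J s) r s j ^+ 2 = \sum_(j in J s) p s j.
  by apply: eq_bigr => j _; rewrite root_sqr.
have A_le1 s : A s <= 1.
  rewrite -(@ler_pXn2r _ 2) ?nnegrE // expr1n exprMn.
  have := sqr_sum_le (J s) (r s); rewrite Jm sum_r => le.
  apply: le_trans (ler_wpM2l (sqr_ge0 um) le) _.
  by rewrite mulrA um1 mul1r.
have A_ge s : 1 - rho <= A s.
  apply: (@le_trans _ _ (A s ^+ 2)); last by rewrite expr2 ler_piMl.
  rewrite exprMn; have := sqr_sum_ge (J s) (r s) c; rewrite Jm sum_r.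
  have massE : mass w s = \sum_(j in J s) p s j + \sum_(j | j \notin J s) p s j.
    by rewrite /mass (bigID (mem (J s))).
  have := mass_ge w0 v0 vw mass1 v1 s; rewrite massE.
  have := Jtail s; have := (Jcore s).2.
  set X := \sum_(j in J s) (_ - _) ^+ 2; set P := \sum_(j in J s) p s j.
  set Q := \sum_(j | _) _; set Y := \sum_(j in J s) _ => h1 h2 h3 h4.
  have : um ^+ 2 * (m%:R * P) <= um ^+ 2 * (Y ^+ 2 + m%:R * X) by rewrite ler_wpM2l ?sqr_ge0.
  rewrite mulrDr !mulrA um1 !mul1r /root_const; move: h3; rewrite -[d.+1%:R]natr1.
  move: (um ^+ 2 * Y ^+ 2) => Z; have := h1; have := h2; lra.
have r_close s : \sum_(j in J s) (r s j - um) ^+ 2 <= 2 * rho.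
  have -> : \sum_(j in J s) (r s j - um) ^+ 2
      = \sum_(j in J s) p s j - 2 * A s + um ^+ 2 * m%:R.
    rewrite -sum_r /A mulrA [_ * m%:R]mulr_natr -(Jm s) -sumr_const mulr_sumr -sumrB -big_split.
    by apply: eq_bigr => j _ /=; ring.
  have := massJ s; have := A_ge s; rewrite um1; lra.
have g_close : \sum_(i in box J) (g i - um ^+ d) ^+ 2 <= 2 * D * rho.
  have -> : \sum_(i in box J) (g i - um ^+ d) ^+ 2
      = \sum_(i in box J) g i ^+ 2 - 2 * (um ^+ d * \sum_(i in box J) g i)
        + (um ^+ d) ^+ 2 * \sum_(i in box J) 1.
    by rewrite !mulr_sumr -sumrB -big_split; apply: eq_bigr => i _ /=; ring.
  rewrite (card_box _ Jm) exprAC -exprMn um1 expr1n.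
  rewrite /prod_dens (sum_box_prod J (fun s j => r s j)).
  have -> : um ^+ d * \prod_s \sum_(j in J s) r s j = \prod_s A s.
    by rewrite big_split /= prodr_const card_ord.
  have g1 : \sum_(i in box J) (\prod_s r s (i s)) ^+ 2 <= 1.
    apply: le_trans (prod_mass_le1 mass1); rewrite -sum_prod_dens.
    rewrite [leRHS](bigID (fun i => i \in box J)) /= lerDl.
    by apply: sumr_ge0 => i _; exact: sqr_ge0.
  have A01 s : 0 <= A s <= 1 by rewrite A0 A_le1.
  have := prod_ge_1Bsum (index_enum 'I_d) A01.
  have : \sum_s (1 - A s) <= D * rho.
    apply: (@le_trans _ _ (\sum_(s < d) rho)).
      by apply: ler_sum => s _; have := A_ge s; lra.
    by rewrite sumr_const card_ord -[leLHS]mulr_natl.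
  move: g1; set X := \sum_(i in _) _; set Y := \prod_s _; set Z := \sum_s _; lra.
exists m, J; split=> //.
  apply: le_trans (tail_le w0 v0 vw mass1 v1 J s0) _.
  have : \sum_s \sum_(j | j \notin J s) p s j <= \sum_(s < d) (4 * kappa + lambda).
    by apply: ler_sum.
  rewrite sumr_const card_ord -[leRHS]mulr_natl /tail_const -[d.+1%:R]natr1.
  set X := \sum_s _; lra.
apply: (@le_trans _ _ (\sum_(i in box J) (64 * um ^+ 2 *
     ((f s0 i - g i) ^+ 2 + (g i - um ^+ d) ^+ 2)
     + 2 * um ^+ (2 * d) * (r s0 (i s0) - um) ^+ 2))).
  apply: ler_sum => i; rewrite mem_box => /forallP/(_ s0)/pJ; rewrite -root_sqr.
  rewrite -(dens_root w0 s0 i) [(2 * d)%N]mulnC exprM [um ^+ d.+1]exprSr.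
  move: (f s0 i) (g i) (r s0 (i s0)) (um ^+ d) => a b e q eu.
  apply: (@le_trans _ _ (2 * ((a - q) ^+ 2 * e ^+ 2) + 2 * q ^+ 2 * (e - um) ^+ 2)).
    rewrite -subr_ge0 (_ : _ - _ = ((a - q) * e - q * (e - um)) ^+ 2) ?sqr_ge0 //; ring.
  rewrite lerD2r; apply: (@le_trans _ _ (2 * ((a - q) ^+ 2 * (16 * um ^+ 2)))).
    by rewrite ler_wpM2l // ler_wpM2l ?sqr_ge0.
  rewrite -subr_ge0 (_ : _ - _ = 32 * um ^+ 2 * (a - 2 * b + q) ^+ 2); last by ring.
  by rewrite mulr_ge0 ?sqr_ge0 // mulr_ge0 ?sqr_ge0.
rewrite big_split /= -!mulr_sumr big_split /= (sum_box_coord _ (fun j => (r s0 j - um) ^+ 2) Jm).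
have umd : um ^+ (2 * d) * m%:R ^+ d.-1 = um ^+ 2.
  have dE : d = d.-1.+1 by rewrite prednK // ltnW.
  by rewrite [in LHS]dE -pred_Sn mulnS exprD exprM -mulrA -exprMn um1 expr1n mulr1.
have close : \sum_(i in box J) (f s0 i - g i) ^+ 2 <= delta.
  apply: le_trans (dens_close w0 v0 vw mass1 v1 s0).
  rewrite [leRHS](bigID (fun i => i \in box J)) /= lerDl.
  by apply: sumr_ge0 => i _; exact: sqr_ge0.
have := r_close s0; move: close g_close.
set X := \sum_(i in _) _; set Y := \sum_(i in _) _; set Z := \sum_(j in _) _ => h1 h2 h3.
have -> : 2 * um ^+ (2 * d) * (m%:R ^+ d.-1 * Z) = um ^+ 2 * (2 * Z).
  by rewrite -umd; ring.
have -> : 64 * um ^+ 2 * (X + Y) + um ^+ 2 * (2 * Z) = (64 * (X + Y) + 2 * Z) * um ^+ 2 by ring.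
apply: ler_wpM2r; first exact: sqr_ge0.
move: h1; rewrite /core_const -[d.+1%:R]natr1; lra.
Qed.

End ModulusStability.

(** * Gluing phases into a chain *)

Section Phases.
Variables (R : realType) (k : scalar_kind) (d n : nat).
Local Notation K := (scalars R k).
Local Notation I := {ffun 'I_d -> 'I_n}.
Variables (J : 'I_d -> {set 'I_n}) (m : nat).
Hypotheses (m0 : (0 < m)%N) (Jm : forall s, #|J s| = m).
Implicit Types (x y i : I) (s t : 'I_d) (j : 'I_n).
Local Notation M := (m%:R ^+ d : R).

Lemma modulus_sqrD (x y z : K) :
  modulus (x - z) ^+ 2 <= 2 * modulus (x - y) ^+ 2 + 2 * modulus (y - z) ^+ 2.
Proof.
apply: (@le_trans _ _ ((modulus (x - y) + modulus (y - z)) ^+ 2)).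
  rewrite lerXn2r ?nnegrE ?addr_ge0 ?modulus_ge0 //.
  by rewrite -[x - z](subrKA y) ler_modulusD.
have := sqr_ge0 (modulus (x - y) - modulus (y - z)); rewrite sqrrB sqrrD; lra.
Qed.

Lemma unimodular_conj (x : K) : modulus x = 1 -> x * conj x = 1.
Proof. by move=> x1; rewrite mulr_conj x1 expr1n rmorph1. Qed.

Lemma box_mix (Q : pred 'I_d) x y : x \in box J -> y \in box J -> mix Q x y \in box J.
Proof.
rewrite !mem_box => /forallP xJ /forallP yJ; apply/forallP => t.
by rewrite ffunE; case: ifP.
Qed.

Let M0 : 0 < M. Proof. by rewrite exprn_gt0 // ltr0n. Qed.

Let cardJ : \sum_(i in box J) (1 : R) = M. Proof. exact: card_box. Qed.

(** A random x in the box makes [mix Q x i] as random as i itself; so some x is no worse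
    than average. *)
Lemma exists_good_restriction (Q : pred 'I_d) (phi : I -> R) :
  exists2 x, x \in box J &
    \sum_(i in box J) phi (mix Q x i) <= \sum_(i in box J) phi i.
Proof.
pose c x : R := (x \in box J)%:R.
have cE (F : I -> R) : \sum_x c x * F x = \sum_(x in box J) F x.
  by rewrite [RHS]big_mkcond; apply: eq_bigr => x _; rewrite /c; case: ifP; rewrite ?mul1r ?mul0r.
have c1 : \sum_x c x = M by rewrite -cardJ -cE; apply: eq_bigr => x _; rewrite mulr1.
have [|||x cx le] := @weighted_pigeonhole R I c
    (fun x => \sum_(i in box J) phi (mix Q x i)) (\sum_(i in box J) phi i).
- by move=> x; rewrite ler0n.
- by rewrite c1.
- rewrite cE c1 (sum_mix (P := mem (box J)) (fun x _ => phi x)); last first.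
    by move=> x y; exact: box_mix.
  rewrite mulr_suml le_eqVlt; apply/orP; left; apply/eqP.
  apply: eq_bigr => x _; rewrite -cardJ mulr_sumr.
  by apply: eq_bigr => ? _; rewrite mulr1.
by exists x => //; move: cx; rewrite /c ltr0n lt0b.
Qed.

Definition depends_below (s : nat) (f : I -> K) :=
  forall x y, (forall t : 'I_d, (t <= s)%N -> x t = y t) -> f x = f y.
Definition depends_above (s : nat) (f : I -> K) :=
  forall x y, (forall t : 'I_d, (s <= t)%N -> x t = y t) -> f x = f y.
Definition unimodular (f : I -> K) := forall x, modulus (f x) = 1.

Definition chain (H : 'I_d.-1 -> 'I_n -> 'I_n -> K) (r : nat) (i : I) : K :=
  \prod_(l < d.-1 | (l < r)%N) H l (i (link_src l)) (i (link_tgt l)).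

Lemma chain_depends H r : depends_below r (chain H r).
Proof.
move=> x y xy; apply: eq_bigr => l lr.
by congr (H _ _ _); apply: xy => //=; exact: ltnW.
Qed.

Lemma chain_unimodular H r : (forall l a b, modulus (H l a b) = 1) -> unimodular (chain H r).
Proof. by move=> H1 x; rewrite modulus_prod big1. Qed.

Lemma chainS H (r : nat) (lr : (r < d.-1)%N) i :
  chain H r.+1 i = H (Ordinal lr) (i (link_src (Ordinal lr))) (i (link_tgt (Ordinal lr)))
    * chain H r i.
Proof.
rewrite /chain (bigD1 (Ordinal lr)) //=; congr (_ * _); apply: eq_bigl => l.
by rewrite ltnS -val_eqE /= andbC -ltn_neqAle.
Qed.

Lemma eq_chain H H' r i :
  (forall l : 'I_d.-1, (l < r)%N -> H l = H' l) -> chain H r i = chain H' r i.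
Proof. by move=> HH'; apply: eq_bigr => l lr; rewrite HH'. Qed.

Variables (z : I -> K) (e : R).
Hypothesis z1 : unimodular z.
(* conditionally on any one coordinate, past and future nearly decouple *)
Hypothesis split_at : forall s : 'I_d, exists f g,
  [/\ unimodular f, unimodular g, depends_below s f, depends_above s g &
      \sum_(i in box J) modulus (z i - f i * g i) ^+ 2 <= e * M].

Let e0 : (0 < d)%N -> 0 <= e.
Proof.
move=> d0; have [f [g [_ _ _ _ le]]] := split_at (Ordinal d0).
rewrite -(ler_pM2r M0) mul0r; apply: le_trans le.
by apply: sumr_ge0 => i _; exact: sqr_ge0.
Qed.

(* the point x with its coordinates at both ends of the link l replaced *)
Let at_link x (l : 'I_d.-1) (a b : 'I_n) : I :=
  [ffun t => if t == link_src l then a else if t == link_tgt l then b else x t].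

(* If z is close both to chain_r g, with g depending on the coordinates from r on, and to
   f g', with g' depending on those from r + 1 on, then freezing the coordinates before r
   shows that g is close to h g', where h depends on the coordinates r and r + 1 only. *)
Let chain_step (r : nat) : (r <= d.-2)%N -> exists H g,
  [/\ forall l a b, modulus (H l a b) = 1, unimodular g, depends_above r g &
      \sum_(i in box J) modulus (z i - chain H r i * g i) ^+ 2 <= (6 ^+ r - 1) * e * M].
Proof.
elim: r => [|r IH] rd.
  exists (fun _ _ _ => 1), z; split=> //; first by move=> *; exact: modulus1.
    by move=> x y xy; congr z; apply/ffunP => t; exact: xy.
  rewrite subrr !mul0r big1 // => i _.
  by rewrite /chain big1 // mul1r subrr modulus0 expr0n.
have [H [g [H1 g1 gd le]]] := IH (ltnW rd).
have lr : (r < d.-1)%N by case: (d) rd => [|[|d']] //= rd; rewrite ltnS ltnW.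
pose l0 := Ordinal lr.
have [f [g' [f1 g'1 fd g'd le']]] := split_at (link_tgt l0).
pose Q : pred 'I_d := fun t => (t < r)%N.
pose phi i := modulus (chain H r i * g i - f i * g' i) ^+ 2.
have [x xJ xle] := exists_good_restriction Q phi.
pose h a b := conj (chain H r (at_link x l0 a b)) * f (at_link x l0 a b).
have C1 := chain_unimodular r H1.
have h1 a b : modulus (h a b) = 1 by rewrite modulusM modulus_conj C1 f1 mulr1.
have linkE i (t : 'I_d) : (t <= r.+1)%N ->
    mix Q x i t = at_link x l0 (i (link_src l0)) (i (link_tgt l0)) t.
  move=> tr; rewrite !ffunE /Q -!val_eqE /=.
  case: (ltngtP t r) => [tl|tl|tE]; last by congr (i _); apply: val_inj.
  - by rewrite ltn_eqF // ltnW.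
  - have tE : nat_of_ord t = r.+1 by apply/eqP; rewrite eqn_leq tr tl.
    by rewrite tE eqxx; congr (i _); apply: val_inj.
have hE i : phi (mix Q x i)
    = modulus (g i - h (i (link_src l0)) (i (link_tgt l0)) * g' i) ^+ 2.
  have -> : h (i (link_src l0)) (i (link_tgt l0))
      = conj (chain H r (mix Q x i)) * f (mix Q x i).
    rewrite /h; congr (conj _ * _).
      by apply: chain_depends => t tr; rewrite linkE // ltnW // ltnS.
    by apply: fd => t /= tr; rewrite linkE.
  rewrite /phi (gd _ i) => [|t rt]; last by rewrite ffunE /Q ltnNge rt.
  rewrite (g'd _ i) => [|t /= rt]; last by rewrite ffunE /Q ltnNge ltnW.
  congr (_ ^+ 2); rewrite -[RHS]mul1r -(C1 (mix Q x i)) -modulusM mulrBr.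
  by rewrite !mulrA (unimodular_conj (C1 _)) mul1r.
pose H' l := if l == l0 then h else H l.
exists H', g'; split=> //.
- by move=> l a b; rewrite /H'; case: ifP.
have chainE i : chain H' r.+1 i = h (i (link_src l0)) (i (link_tgt l0)) * chain H r i.
  rewrite chainS {1}/H' eqxx; congr (_ * _); apply: eq_chain => l lr'.
  by rewrite /H' -val_eqE /= ltn_eqF.
have phiB : \sum_(i in box J) phi i
    <= 2 * ((6 ^+ r - 1) * e * M) + 2 * (e * M).
  apply: (@le_trans _ _ (\sum_(i in box J) (2 * modulus (z i - chain H r i * g i) ^+ 2
      + 2 * modulus (z i - f i * g' i) ^+ 2))).
    apply: ler_sum => i _; rewrite [modulus (z i - _ * g i)]modulusB.
    exact: modulus_sqrD.
  by rewrite big_split /= -!mulr_sumr lerD // ler_wpM2l.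
have step : \sum_(i in box J) modulus (z i - chain H' r.+1 i * g' i) ^+ 2
    <= 2 * ((6 ^+ r - 1) * e * M) + 2 * \sum_(i in box J) phi i.
  apply: (@le_trans _ _ (\sum_(i in box J) (2 * modulus (z i - chain H r i * g i) ^+ 2
      + 2 * phi (mix Q x i)))).
    apply: ler_sum => i _; apply: le_trans (modulus_sqrD _ (chain H r i * g i) _) _.
    rewrite lerD2l hE chainE [_ * chain H r i]mulrC -mulrA -mulrBr modulusM C1 mul1r.
    by [].
  by rewrite big_split /= -!mulr_sumr lerD // ler_wpM2l.
apply: le_trans step _; apply: le_trans (lerD (lexx _) (ler_wpM2l _ phiB)) _ => //.
have e0' : 0 <= e by apply: e0; apply: leq_trans (leq_pred d); exact: (leq_ltn_trans (leq0n r) lr).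
have : 0 <= e * M by rewrite mulr_ge0 // ltW.
rewrite exprS; set E := 6 ^+ r; rewrite -!mulrA; set X := e * _ => X0; lra.
Qed.

(** As for a Markov chain, decoupling at each coordinate gives a product of functions of
    consecutive coordinates: [chain_step] splits off the links one by one, and what
    remains after all links but the last depends on the last two coordinates only. *)
Lemma phase_chain : (2 <= d)%N -> exists H : 'I_d.-1 -> 'I_n -> 'I_n -> K,
  (forall l a b, modulus (H l a b) = 1) /\
  \sum_(i in box J) modulus (z i - \prod_l H l (i (link_src l)) (i (link_tgt l))) ^+ 2
    <= 6 ^+ d * e * M.
Proof.
move=> d2; have [H [g [H1 g1 gd le]]] := chain_step (leqnn _).
have lr : (d.-2 < d.-1)%N by case: (d) d2 => [|[]].
pose l0 := Ordinal lr.
have [x xJ _] := exists_good_restriction xpredT (fun=> 0).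
pose H' l := if l == l0 then fun a b => g (at_link x l0 a b) else H l.
exists H'; split; first by move=> l a b; rewrite /H'; case: ifP => // _; exact: g1.
have chainE i : \prod_l H' l (i (link_src l)) (i (link_tgt l)) = chain H d.-2 i * g i.
  have -> : \prod_l H' l (i (link_src l)) (i (link_tgt l)) = chain H' d.-2.+1 i.
    apply: eq_bigl => l; have := ltn_ord l.
    by case: (d) d2 l => [|[]].
  rewrite chainS {1}/H' eqxx mulrC; congr (_ * _).
    by apply: eq_chain => l lr'; rewrite /H' -val_eqE /= ltn_eqF.
  apply: gd => t td; rewrite ffunE -!val_eqE /=.
  have tS : (t < d.-2.+2)%N by case: (d) d2 t td => [|[]] //= d' _ t _; exact: ltn_ord.
  case: eqP => [tE|/eqP tE]; first by congr (i _); apply: val_inj.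
  have tE' : nat_of_ord t = d.-2.+1.
    by apply/eqP; rewrite eqn_leq -ltnS tS ltn_neqAle eq_sym tE td.
  by rewrite tE' eqxx; congr (i _); apply: val_inj.
under eq_bigr => i _ do rewrite chainE.
apply: le_trans le _.
have e0' : 0 <= e by apply: e0; exact: ltnW.
rewrite ler_wpM2r ?(ltW M0) // ler_wpM2r //.
have : (6 : R) ^+ d.-2 <= 6 ^+ d.
  by rewrite ler_weXn2l ?ler1n // -subn2 leq_subr.
lra.
Qed.

End Phases.

(** * Decoupling of the phases *)

Section PhaseSplit.
Variables (R : realType) (k : scalar_kind).
Local Notation K := (scalars R k).

Definition phase (x : K) : K := if x == 0 then 1 else x / of_real k (modulus x).

Lemma modulus_phase x : modulus (phase x) = 1.
Proof.
rewrite /phase; case: eqVneq => [_|x0]; first exact: modulus1.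
rewrite modulusM modulusV modulus_of_real ger0_norm ?modulus_ge0 //.
by rewrite divff // modulus_eq0.
Qed.

Lemma phaseE x : x = of_real k (modulus x) * phase x.
Proof.
rewrite /phase; case: eqVneq => [->|x0]; first by rewrite modulus0 rmorph0 mul0r.
by rewrite mulrC divfK // fmorph_eq0 modulus_eq0.
Qed.

Lemma modulusB_real (x : K) (r : R) :
  modulus (x - of_real k r * phase x) ^+ 2 = (modulus x - r) ^+ 2.
Proof.
rewrite {1}(phaseE x) -mulrBl -rmorphB modulusM modulus_phase mulr1 modulus_of_real.
by rewrite real_normK ?num_real.
Qed.

Lemma phase_dist (x y X Y : K) : modulus X = 1 -> modulus Y = 1 ->
  x = of_real k (modulus x) * X -> y = of_real k (modulus y) * Y ->
  modulus x * modulus (X - Y) <= 2 * modulus (x - y).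
Proof.
move=> X1 Y1 xE yE.
have -> : modulus x * modulus (X - Y) = modulus (x - of_real k (modulus x) * Y).
  have -> : x - of_real k (modulus x) * Y = of_real k (modulus x) * (X - Y).
    by rewrite mulrBr -xE.
  by rewrite modulusM modulus_of_real ger0_norm ?modulus_ge0.
have -> : x - of_real k (modulus x) * Y
    = (x - y) + of_real k (modulus y - modulus x) * Y.
  by rewrite rmorphB mulrBl /= -yE; ring.
apply: le_trans (ler_modulusD _ _) _.
rewrite modulusM Y1 mulr1 modulus_of_real.
suff : `|modulus y - modulus x| <= modulus (x - y) by lra.
rewrite ler_norml; apply/andP; split.
  have := ler_modulusD (x - y) y; rewrite subrK; lra.
by have := ler_modulusD (y - x) x; rewrite subrK modulusB; lra.
Qed.

(** If b1 and b2 have modulus at least 1/2, the phases of two numbers are at most eight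
    times as far apart as the numbers themselves; otherwise one of the last two terms
    is at least 4, the largest possible value of the left-hand side. *)
Lemma phase_dist_sqr (b1 b2 b3 b4 : K) :
  modulus (phase b1 * phase b2 - phase b3 * phase b4) ^+ 2
  <= 64 * modulus (b1 * b2 - b3 * b4) ^+ 2
     + 16 * (modulus b1 - 1) ^+ 2 + 16 * (modulus b2 - 1) ^+ 2.
Proof.
set X := phase b1 * phase b2; set Y := phase b3 * phase b4.
have X1 : modulus X = 1 by rewrite modulusM !modulus_phase mulr1.
have Y1 : modulus Y = 1 by rewrite modulusM !modulus_phase mulr1.
have XE b b' : b * b' = of_real k (modulus (b * b')) * (phase b * phase b').
  by rewrite {1}(phaseE b) {1}(phaseE b') modulusM rmorphM /=; ring.
have XY2 : modulus (X - Y) ^+ 2 <= 4.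
  have : modulus (X - Y) <= 2.
    by have := ler_modulusD X (- Y); rewrite modulusN X1 Y1.
  move=> le; have -> : 4 = 2 ^+ 2 :> R by ring.
  by rewrite lerXn2r ?nnegrE ?modulus_ge0.
have far (b : K) : modulus b < 2^-1 -> 4 <= 16 * (modulus b - 1) ^+ 2.
  move=> bh; have : (2^-1) ^+ 2 <= (1 - modulus b) ^+ 2.
    by rewrite lerXn2r ?nnegrE ?invr_ge0 ?subr_ge0 //; move: bh; lra.
  rewrite exprVn; lra.
have s0 (x : R) : 0 <= x ^+ 2 := sqr_ge0 x.
have [/far|b1h] := ltP (modulus b1) 2^-1.
  by have := s0 (modulus b2 - 1); have := s0 (modulus (b1 * b2 - b3 * b4)); lra.
have [/far|b2h] := ltP (modulus b2) 2^-1.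
  by have := s0 (modulus b1 - 1); have := s0 (modulus (b1 * b2 - b3 * b4)); lra.
have : modulus (X - Y) ^+ 2 <= (8 * modulus (b1 * b2 - b3 * b4)) ^+ 2.
  rewrite lerXn2r ?nnegrE ?modulus_ge0 ?mulr_ge0 ?modulus_ge0 //.
  have := phase_dist X1 Y1 (XE b1 b2) (XE b3 b4).
  have : 2^-1 * 2^-1 <= modulus (b1 * b2) by rewrite modulusM ler_pM.
  move=> h1 h2.
  have := ler_wpM2r (modulus_ge0 (X - Y)) h1; lra.
by rewrite exprMn; have := s0 (modulus b1 - 1); have := s0 (modulus b2 - 1); lra.
Qed.

(* in the application b_i is the coefficient divided by the common modulus m^(-(d+1)/2) *)
Variables (d n : nat).
Local Notation I := {ffun 'I_d -> 'I_n}.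
Variables (J : 'I_d -> {set 'I_n}) (m : nat) (s : 'I_d).
Hypotheses (m0 : (0 < m)%N) (Jm : forall s, #|J s| = m).
Variables (b : I -> K) (e1 e2 : R).
Local Notation M := (m%:R ^+ d : R).
Local Notation N := (m%:R ^+ d.-1 : R).
Hypothesis b_near1 : \sum_(i in box J) (modulus (b i) - 1) ^+ 2 <= e1 * M.
Hypothesis minors_small :
  \sum_(i in box J) \sum_(i' in box J | i' s == i s)
    modulus (b i * b i' - b (splice s i i') * b (splice s i' i)) ^+ 2 <= e2 * N * M.
Local Notation z := (fun i => phase (b i)).

Let N0 : 0 < N. Proof. by rewrite exprn_gt0 // ltr0n. Qed.

Let card_slice j : j \in J s -> \sum_(i in box J | i s == j) (1 : R) = N.
Proof.
move=> jJ; rewrite -[RHS]mulr1 big_mkcondr /=.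
rewrite (sum_box_coord s (fun l => if l == j then 1 else 0 : R) Jm); congr (_ * _).
by rewrite (bigD1 j) //= eqxx big1 ?addr0 // => l /andP[_ /negPf ->].
Qed.

Let slice_sum (F : I -> I -> R) :
  \sum_(i in box J) \sum_(i' in box J | i' s == i s) F i i'
  = \sum_(j in J s) \sum_(i in box J | i s == j) \sum_(i' in box J | i' s == j) F i i'.
Proof.
rewrite (partition_big (fun i : I => i s) (mem (J s))) /=.
  by apply: eq_bigr => j _; apply: eq_bigr => i /andP[_ /eqP ->].
by move=> i; rewrite mem_box => /forallP.
Qed.

Let slice_const (F : I -> R) :
  \sum_(i in box J) \sum_(i' in box J | i' s == i s) F i = N * \sum_(i in box J) F i.
Proof.
rewrite mulr_sumr; apply: eq_bigr => i; rewrite mem_box => /forallP/(_ s) iJ.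
by rewrite -(card_slice iJ) mulr_suml; apply: eq_bigr => ? _; rewrite mul1r.
Qed.

Let slice_const' (F : I -> R) :
  \sum_(i in box J) \sum_(i' in box J | i' s == i s) F i' = N * \sum_(i in box J) F i.
Proof.
rewrite -slice_const !slice_sum; apply: eq_bigr => j _.
by rewrite exchange_big.
Qed.

Let Phi i i' := modulus (z i * z i' - z (splice s i i') * z (splice s i' i)) ^+ 2.

Let sum_Phi : \sum_(i in box J) \sum_(i' in box J | i' s == i s) Phi i i'
  <= (64 * e2 + 32 * e1) * N * M.
Proof.
apply: (@le_trans _ _ (\sum_(i in box J) \sum_(i' in box J | i' s == i s)
  (64 * modulus (b i * b i' - b (splice s i i') * b (splice s i' i)) ^+ 2
     + 16 * (modulus (b i) - 1) ^+ 2 + 16 * (modulus (b i') - 1) ^+ 2))).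
  by do 2!apply: ler_sum => ? _; exact: phase_dist_sqr.
have splitB : \sum_(i in box J) \sum_(i' in box J | i' s == i s)
  (64 * modulus (b i * b i' - b (splice s i i') * b (splice s i' i)) ^+ 2
     + 16 * (modulus (b i) - 1) ^+ 2 + 16 * (modulus (b i') - 1) ^+ 2)
  = 64 * (\sum_(i in box J) \sum_(i' in box J | i' s == i s)
      modulus (b i * b i' - b (splice s i i') * b (splice s i' i)) ^+ 2)
    + 16 * (\sum_(i in box J) \sum_(i' in box J | i' s == i s) (modulus (b i) - 1) ^+ 2)
    + 16 * (\sum_(i in box J) \sum_(i' in box J | i' s == i s) (modulus (b i') - 1) ^+ 2).
  rewrite !mulr_sumr -!big_split; apply: eq_bigr => i _ /=.
  by rewrite !mulr_sumr -!big_split.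
rewrite splitB slice_const (slice_const' (fun i => (modulus (b i) - 1) ^+ 2)).
have := ler_wpM2l (ltW N0) b_near1; have := minors_small.
set X := \sum_(i in _) \sum_(i' in _ | _) _; set Y := \sum_(i in _) _; lra.
Qed.

(** A unimodular matrix with vanishing minors is the product of one of its columns and one
    of its rows, divided by their common entry. In each slice the common entry is chosen
    so that the sum of the squared minors through it is no worse than average. *)
Lemma phase_split : exists f g : I -> K,
  [/\ unimodular f, unimodular g, depends_below s f, depends_above s g &
      \sum_(i in box J) modulus (z i - f i * g i) ^+ 2 <= (64 * e2 + 32 * e1) * M].
Proof.
have base j : exists x : I, j \in J s ->
    [/\ x \in box J, x s = j & N * \sum_(i in box J | i s == j) Phi i x
      <= \sum_(i in box J | i s == j) \sum_(i' in box J | i' s == j) Phi i i'].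
  have [jJ|jJ] := boolP (j \in J s); last by exists [ffun=> j].
  pose c x : R := ((x \in box J) && (x s == j))%:R.
  have cE (F : I -> R) : \sum_x c x * F x = \sum_(x in box J | x s == j) F x.
    rewrite [RHS]big_mkcond; apply: eq_bigr => x _; rewrite /c.
    by case: ifP; rewrite ?mul1r ?mul0r.
  have cN : \sum_x c x = N.
    by rewrite -(card_slice jJ) -cE; apply: eq_bigr => x _; rewrite mulr1.
  have [|||x cx le] := @weighted_pigeonhole R I c
      (fun x => N * \sum_(i in box J | i s == j) Phi i x)
      (\sum_(i in box J | i s == j) \sum_(i' in box J | i' s == j) Phi i i').
  - by move=> x; rewrite ler0n.
  - by rewrite cN.
  - by rewrite cE cN -mulr_sumr mulrC exchange_big.
  by exists x => _; move: cx; rewrite /c ltr0n lt0b => /andP[xJ /eqP].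
have [x xP] := choice base.
exists (fun i : I => z (splice s i (x (i s)))),
  (fun i : I => z (splice s (x (i s)) i) * conj (z (x (i s)))); split.
- by move=> i; exact: modulus_phase.
- by move=> i; rewrite modulusM modulus_conj !modulus_phase mulr1.
- move=> i i' ii'; rewrite (ii' s) //; congr (phase (b _)).
  by apply/ffunP => t; rewrite !ffunE; case: ifP => // /ii'.
- move=> i i' ii'; rewrite (ii' s) //; congr (phase (b _) * _).
  apply/ffunP => t; rewrite !ffunE; case: leqP => // /ltnW /ii' //.
have -> : \sum_(i in box J) modulus (z i - z (splice s i (x (i s)))
      * (z (splice s (x (i s)) i) * conj (z (x (i s))))) ^+ 2
    = \sum_(i in box J) Phi i (x (i s)).
  apply: eq_bigr => i _; congr (_ ^+ 2).
  rewrite -[LHS]mulr1 -(modulus_phase (b (x (i s)))) -modulusM mulrBl -!mulrA.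
  by rewrite [conj _ * _]mulrC unimodular_conj ?modulus_phase // mulr1.
rewrite -(ler_pM2l N0); apply: le_trans (_ : _ <= (64 * e2 + 32 * e1) * N * M) _; last first.
  by rewrite [N * _]mulrC mulrAC.
apply: le_trans sum_Phi; rewrite slice_sum mulr_sumr.
rewrite [X in X <= _](partition_big (fun i : I => i s) (mem (J s))) /=; last first.
  by move=> i; rewrite mem_box => /forallP.
apply: ler_sum => j jJ; have [_ _] := xP j jJ; apply: le_trans.
by rewrite mulr_sumr; apply: ler_sum => i /andP[_ /eqP ->].
Qed.

End PhaseSplit.

(** * Stability of the coefficients *)

Section CoefficientStability.
Variables (R : realType) (k : scalar_kind) (d n : nat).
Local Notation K := (scalars R k).
Local Notation I := {ffun 'I_d -> 'I_n}.
Local Notation D := (d%:R : R).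
Local Notation u m := ((Num.sqrt (m%:R : R))^-1).

Lemma slice_minors_eq0 (a : I -> K) s j :
  slice_norm (fun i => modulus (a i)) s j = 0 -> slice_minors a s j = 0.
Proof.
move=> p0; have a0 (i : I) : i s = j -> a i = 0.
  move=> ij; apply/eqP; rewrite -modulus_eq0 eq_le modulus_ge0 andbT -p0 -ij.
  by apply: (ler_slice_norm (w := fun i => modulus (a i))); exact: modulus_ge0.
apply: big1 => i /eqP ij; apply: big1 => i' /eqP ij'.
by rewrite !a0 ?splice_at // mulr0 subr0 modulus0 expr0n.
Qed.

Definition decoupling_const : R := 64 * (16 ^+ 3 * 4 * (D + 1)) + 32 * core_const R d.
Definition approx_const : R := 2 * core_const R d + 2 * (6 ^+ d * decoupling_const).

Lemma approx_const_ge0 : 0 <= approx_const.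
Proof.
have c0 := core_const_ge0 R d; have D0 : 0 <= D := ler0n _ _.
have dec0 : 0 <= decoupling_const.
  have := mulr_ge0 (exprn_ge0 3 (ler0n R 16)) (addr_ge0 D0 ler01).
  rewrite /decoupling_const; set X := 16 ^+ 3; lra.
by have := mulr_ge0 (exprn_ge0 d (ler0n R 6)) dec0; rewrite /approx_const; lra.
Qed.

Variables (a : I -> K) (v : I -> R) (eta : R).
Local Notation w := (fun i => modulus (a i)).
Local Notation p := (slice_norm w).
Hypothesis v0 : forall i, 0 <= v i.
Hypothesis vw : forall i, v i ^+ d.+1 = modulus (a i) ^+ (2 * d).
Hypothesis cb : forall s, \sum_j (p s j + slice_minors a s j / (4 * p s j ^+ 3)) <= 1.
Hypothesis v1 : 1 - eta <= \sum_i v i.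
Hypothesis d2 : (2 <= d)%N.
Hypothesis eta0 : 0 <= eta.
Hypothesis eta_small : size_const R d * eta <= 2^-1.

Let minors0 s j : 0 <= slice_minors a s j.
Proof. by do 2!apply: sumr_ge0 => ? _; exact: sqr_ge0. Qed.

Let minors_p0 s j : 0 <= slice_minors a s j / (4 * p s j ^+ 3).
Proof. by rewrite divr_ge0 // mulr_ge0 // exprn_ge0 // slice_norm_ge0. Qed.

Let w0 i : 0 <= w i. Proof. exact: modulus_ge0. Qed.

Let mass1 s : mass w s <= 1.
Proof. by apply: le_trans (cb s); apply: ler_sum => j _; rewrite lerDl. Qed.

Let minors_sum s : \sum_j slice_minors a s j / p s j ^+ 3 <= 4 * ((D + 1) * eta).
Proof.
have := cb s; rewrite big_split /=.
have := mass_ge w0 v0 vw mass1 v1 s; rewrite /mass -[d.+1%:R]natr1.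
have -> : \sum_j slice_minors a s j / p s j ^+ 3
    = 4 * \sum_j slice_minors a s j / (4 * p s j ^+ 3).
  rewrite mulr_sumr; apply: eq_bigr => j _.
  by rewrite [(4 * _)^-1]invfM [RHS]mulrCA [4 * _]mulrA mulfV ?mul1r ?pnatr_eq0.
set X := \sum_j p s j; set Y := \sum_j _; lra.
Qed.

(** The moduli are given by [modulus_stability]. The mixed norms use up all but O(eta) of
    the slice inequality, so what remains bounds the minors; [phase_split] and
    [phase_chain] then apply to the phases. *)
Lemma coefficient_stability : exists m (J : 'I_d -> {set 'I_n})
    (H : 'I_d.-1 -> 'I_n -> 'I_n -> K),
  [/\ (0 < m)%N, forall s, #|J s| = m, forall l x y, modulus (H l x y) = 1,
      \sum_(i | i \notin box J) v i <= tail_const R d * eta &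
      \sum_(i in box J) modulus (a i - of_real k (u m ^+ d.+1)
          * \prod_l H l (i (link_src l)) (i (link_tgt l))) ^+ 2
        <= approx_const * eta * u m ^+ 2].
Proof.
have [m [J [m0 Jm tail core pJ]]] :=
  modulus_stability w0 v0 vw mass1 v1 d2 eta0 eta_small.
set um := u m; have um1 : um ^+ 2 * m%:R = 1 := invsqrt_sqr R m0.
have mgt0 : 0 < m%:R :> R by rewrite ltr0n.
have um0 : 0 < um by rewrite invr_gt0 sqrtr_gt0.
pose h := um ^+ d.+1; have h0 : 0 < h by rewrite exprn_gt0.
pose b i := a i / of_real k h.
have modb i : modulus (b i) = modulus (a i) / h.
  by rewrite modulusM modulusV modulus_of_real gtr0_norm.
have hM : h ^- 2 * um ^+ 2 = m%:R ^+ d.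
  have uM : um ^+ (2 * d) * m%:R ^+ d = 1 by rewrite exprM -exprMn um1 expr1n.
  have h2 : h ^+ 2 != 0 by rewrite expf_neq0 // gt_eqF.
  apply: (mulfI h2); rewrite mulrA mulfV // mul1r.
  by rewrite /h -exprM mulnC mulnS exprD -mulrA uM mulr1.
have near1 : \sum_(i in box J) (modulus (b i) - 1) ^+ 2 <= (core_const R d * eta) * m%:R ^+ d.
  rewrite -hM [h ^- 2 * _]mulrC mulrA -ler_pdivrMr ?invr_gt0 ?exprn_gt0 // invrK.
  apply: le_trans core; rewrite mulr_suml le_eqVlt; apply/orP; left; apply/eqP.
  by apply: eq_bigr => i _; rewrite modb -exprMn mulrBl divfK ?gt_eqF // mul1r.
have minors s : \sum_(i in box J) \sum_(i' in box J | i' s == i s)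
    modulus (b i * b i' - b (splice s i i') * b (splice s i' i)) ^+ 2
  <= (16 ^+ 3 * 4 * (D + 1) * eta) * m%:R ^+ d.-1 * m%:R ^+ d.
  apply: (@le_trans _ _ (h ^- 4 * \sum_(j in J s) slice_minors a s j)).
    rewrite (partition_big (fun i : I => i s) (mem (J s))) /=; last first.
      by move=> i; rewrite mem_box => /forallP.
    rewrite mulr_sumr; apply: ler_sum => j _.
    rewrite /slice_minors mulr_sumr [leRHS](bigID (mem (box J))) /= -[leLHS]addr0.
    have t0 i i' : 0 <= h ^- 4 * modulus (a i * a i' - a (splice s i i') * a (splice s i' i)) ^+ 2.
      by rewrite mulr_ge0 ?sqr_ge0 // invr_ge0 exprn_ge0 // ltW.
    apply: lerD; last by apply: sumr_ge0 => i _; rewrite mulr_sumr; apply: sumr_ge0.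
    rewrite [leRHS](eq_bigl (fun i : I => (i \in box J) && (i s == j))); last first.
      by move=> i; rewrite andbC.
    apply: ler_sum => i /andP[_ /eqP ->].
    rewrite mulr_sumr [leRHS](bigID (mem (box J))) /= -[leLHS]addr0.
    apply: lerD; last by apply: sumr_ge0.
    rewrite [leRHS](eq_bigl (fun i : I => (i \in box J) && (i s == j))); last first.
      by move=> i'; rewrite andbC.
    rewrite le_eqVlt; apply/orP; left; apply/eqP; apply: eq_bigr => i' _.
    have -> : b i * b i' - b (splice s i i') * b (splice s i' i)
        = (a i * a i' - a (splice s i i') * a (splice s i' i)) * of_real k (h ^- 2).
      have -> : of_real k (h ^- 2) = (of_real k h)^-1 * (of_real k h)^-1.
        by rewrite -exprVn expr2 rmorphM fmorphV.
      by rewrite /b; move: (of_real k h)^-1 => y; ring.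
    rewrite modulusM modulus_of_real ger0_norm ?invr_ge0 ?sqr_ge0 //.
    by rewrite exprMn mulrC -exprVn -exprM exprVn.
  have le : \sum_(j in J s) slice_minors a s j <= (16 * um ^+ 2) ^+ 3 * (4 * ((D + 1) * eta)).
    apply: le_trans (ler_wpM2l _ (minors_sum s)); last first.
      by rewrite exprn_ge0 // mulr_ge0 // sqr_ge0.
    rewrite mulr_sumr [leRHS](bigID (mem (J s))) /= -[leLHS]addr0.
    have t0 j : 0 <= (16 * um ^+ 2) ^+ 3 * (slice_minors a s j / p s j ^+ 3).
      rewrite mulr_ge0 ?divr_ge0 ?exprn_ge0 ?slice_norm_ge0 //.
      by rewrite mulr_ge0 // sqr_ge0.
    apply: lerD; last by apply: sumr_ge0.
    apply: ler_sum => j jJ; have pj := pJ s j jJ; have [p0|p0] := eqVneq (p s j) 0.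
      by rewrite slice_minors_eq0 // mul0r mulr0.
    rewrite mulrA ler_pdivlMr ?exprn_gt0 ?lt_def ?p0 ?slice_norm_ge0 //.
    rewrite mulrC; apply: ler_wpM2r => //.
    by rewrite lerXn2r ?nnegrE ?slice_norm_ge0 // (le_trans _ pj) // slice_norm_ge0.
  apply: le_trans (ler_wpM2l _ le) _; first by rewrite invr_ge0 exprn_ge0 // ltW.
  rewrite le_eqVlt; apply/orP; left; apply/eqP.
  have m1 : um ^+ 2 * m%:R ^+ d = m%:R ^+ d.-1.
    by rewrite -{1}(prednK (ltnW d2)) [m%:R ^+ _]exprS mulrA um1 mul1r.
  have -> : h ^- 4 = h ^- 2 * h ^- 2 by rewrite -invfM -exprD.
  by rewrite -m1 -hM; ring.
pose e := (64 * (16 ^+ 3 * 4 * (D + 1) * eta) + 32 * (core_const R d * eta)).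
have splits s := phase_split m0 Jm near1 (minors s).
have [H [H1 Hz]] := phase_chain m0 Jm (fun i => modulus_phase (b i)) splits d2.
exists m, J, H; split=> //; rewrite -/um -/h.
have phase_ab i : phase (b i) = phase (a i).
  rewrite /phase /b mulf_eq0 invr_eq0 fmorph_eq0 (gt_eqF h0) orbF.
  case: eqVneq => // ai0; rewrite modulusM modulusV modulus_of_real gtr0_norm //.
  by rewrite rmorphM fmorphV /= invfM invrK mulrACA mulVf ?mulr1 // fmorph_eq0 gt_eqF.
apply: (@le_trans _ _ (\sum_(i in box J) (2 * (modulus (a i) - h) ^+ 2 + 2 * h ^+ 2
   * modulus (phase (b i) - \prod_l H l (i (link_src l)) (i (link_tgt l))) ^+ 2))).
  apply: ler_sum => i _.
  apply: le_trans (modulus_sqrD _ (of_real k h * phase (a i)) _) _.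
  rewrite modulusB_real lerD2l -mulrBr modulusM modulus_of_real gtr0_norm //.
  by rewrite exprMn mulrA phase_ab.
rewrite big_split /= -!mulr_sumr.
have : 0 <= 2 * h ^+ 2 by rewrite mulr_ge0 // sqr_ge0.
move=> h20; have := ler_wpM2l h20 Hz; clear h20.
have -> : 2 * h ^+ 2 * (6 ^+ d * (64 * (16 ^+ 3 * 4 * (D + 1) * eta)
     + 32 * (core_const R d * eta)) * m%:R ^+ d)
   = 2 * (6 ^+ d * decoupling_const) * eta * um ^+ 2.
  have h2 : h ^+ 2 != 0 by rewrite expf_neq0 // gt_eqF.
  rewrite -hM /decoupling_const.
  by rewrite -[RHS]mul1r -(divff h2); ring.
have := core; rewrite -/um -/h /approx_const.
set X := \sum_(i in _) (_ - _) ^+ 2; set Y := \sum_(i in _) modulus _ ^+ 2; lra.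
Qed.

End CoefficientStability.

(** * The exponent 2 d / (d + 1) *)

Section Exponent.
Variables (R : realType) (d : nat).
Hypothesis d1 : (0 < d)%N.
Local Notation D := (d%:R : R).

Definition bh_exponent : R := 2 * D / (D + 1).
Local Notation q := bh_exponent.

Let D1 : 1 <= D. Proof. by rewrite ler1n. Qed.
Let Dp : 0 < D + 1. Proof. by rewrite ltr_wpDl // ler0n. Qed.

Lemma bh_exponent_ge1 : 1 <= q.
Proof. by rewrite ler_pdivlMr // mul1r; have := D1; lra. Qed.

Lemma bh_exponent_gt0 : 0 < q. Proof. exact: lt_le_trans bh_exponent_ge1. Qed.

Lemma bh_exponent_le2 : q <= 2.
Proof. by rewrite ler_pdivrMr //; lra. Qed.

Lemma bh_exponentM : d.+1%:R * q = (2 * d)%:R.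
Proof. by rewrite natrM -natr1 mulrC divfK ?gt_eqF. Qed.

Lemma powq_exp (x : R) : 0 <= x -> (x `^ q) ^+ d.+1 = x ^+ (2 * d).
Proof.
move=> x0; rewrite -powR_mulrn ?powR_ge0 // -powRrM mulrC bh_exponentM.
by rewrite powR_mulrn.
Qed.

Lemma exp_powq (x : R) : 0 <= x -> (x ^+ d.+1) `^ q = x ^+ (2 * d).
Proof. by move=> x0; rewrite -powR_mulrn // -powRrM bh_exponentM powR_mulrn. Qed.

Lemma powq_le (y : R) : 0 <= y -> y `^ q <= y ^+ 2 + 1.
Proof.
move=> y0; have [y1|y1] := leP 1 y.
  apply: (@le_trans _ _ (y `^ 2%:R)); last by rewrite powR_mulrn // lerDl.
  exact/ler_powR/bh_exponent_le2.
apply: (@le_trans _ _ 1); last by rewrite lerDr sqr_ge0.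
have : y `^ q <= 1 `^ q.
  by rewrite ge0_ler_powR ?nnegrE ?(ltW bh_exponent_gt0) // ltW.
by rewrite powR1.
Qed.

Lemma sqr_le_powq (y : R) : 0 <= y <= 1 -> y ^+ 2 <= y `^ q.
Proof.
move=> /andP[]; rewrite le_eqVlt => /predU1P[<- _|y0 y1].
  by rewrite expr0n /= powR_ge0.
rewrite -powR_mulrn ?(ltW y0) //; apply: ger_powR bh_exponent_le2.
by rewrite y0.
Qed.

(** Hoelder's inequality on a set of m^d points, up to the factor 2: sum the bounds y^q <= y^2 + 1
    for y = x / l, where l = c m^(-(d+1)/2) is the size of a constant x with equality in
    the hypothesis. *)
Lemma sum_powq_box (I : finType) (P : pred I) (x : I -> R) (m : nat) (c : R) :
  (0 < m)%N -> \sum_(i | P i) (1 : R) = m%:R ^+ d -> (forall i, 0 <= x i) -> 0 <= c ->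
  \sum_(i | P i) x i ^+ 2 <= c ^+ 2 * (Num.sqrt m%:R)^-1 ^+ 2 ->
  \sum_(i | P i) x i `^ q <= 2 * c `^ q.
Proof.
move=> m0 card x0 c0; set u := (Num.sqrt m%:R)^-1.
have mgt0 : 0 < m%:R :> R by rewrite ltr0n.
have u0 : 0 < u by rewrite invr_gt0 sqrtr_gt0.
have um : u ^+ 2 * m%:R = 1 := invsqrt_sqr R m0.
move: c0; rewrite le_eqVlt => /predU1P[<-|c0] le.
  have x00 i : P i -> x i = 0.
    move=> Pi; have : \sum_(i | P i) x i ^+ 2 == 0.
      rewrite eq_le sumr_ge0 ?andbT => [|*]; last exact: sqr_ge0.
      by apply: le_trans le _; rewrite expr0n mul0r.
    rewrite psumr_eq0 => [/allP/(_ i (mem_index_enum i))|*]; last exact: sqr_ge0.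
    by rewrite Pi /= sqrf_eq0 => /eqP.
  rewrite big1 ?mulr_ge0 ?powR_ge0 // => i Pi.
  by rewrite x00 // powR0 // gt_eqF // bh_exponent_gt0.
pose l := c * u ^+ d.+1; have l0 : 0 < l by rewrite mulr_gt0 // exprn_gt0.
have uM : u ^+ (2 * d) * m%:R ^+ d = 1 by rewrite exprM -exprMn um expr1n.
have lq : l `^ q * m%:R ^+ d = c `^ q.
  rewrite powRM ?exprn_ge0 ?(ltW u0) ?(ltW c0) // exp_powq ?(ltW u0) //.
  by rewrite -mulrA uM mulr1.
apply: (@le_trans _ _ (l `^ q * \sum_(i | P i) ((x i / l) ^+ 2 + 1))).
  rewrite mulr_sumr; apply: ler_sum => i _.
  have xl : 0 <= x i / l by rewrite divr_ge0 // ltW.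
  rewrite -{1}[x i](divfK (lt0r_neq0 l0)) mulrC powRM ?(ltW l0) //.
  by rewrite ler_wpM2l ?powR_ge0 // powq_le.
rewrite big_split /= card; under eq_bigr => i _ do rewrite expr_div_n.
rewrite -mulr_suml.
have : (\sum_(i | P i) x i ^+ 2) / l ^+ 2 <= m%:R ^+ d.
  rewrite ler_pdivrMr ?exprn_gt0 //; apply: le_trans le _.
  have -> : l ^+ 2 = c ^+ 2 * u ^+ 2 * u ^+ (2 * d).
    by rewrite exprMn -exprM mulnC mulnS exprD mulrA.
  by rewrite [leRHS]mulrC -[leRHS]mulrA uM mulr1.
move=> h; rewrite -lq [2 * _]mulrC -mulrA.
by rewrite ler_wpM2l ?powR_ge0 //; lra.
Qed.

End Exponent.

(** * The form with given coefficients *)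

Section FormOfCoef.
Variables (R : realType) (k : scalar_kind) (d n : nat).
Local Notation K := (scalars R k).
Local Notation I := {ffun 'I_d -> 'I_n}.
Variable c : I -> K.

Definition form_of_coef (x : {ffun 'I_d -> 'rV[K]_n}) : K :=
  \sum_i c i * \prod_s x s 0 (i s).

Lemma form_of_coef_multilinear : multilinear form_of_coef.
Proof.
move=> s x a u v; rewrite /form_of_coef /= mulr_sumr -big_split /=.
apply: eq_bigr => i _.
have E (y : 'rV[K]_n) : \prod_t [ffun t => if t == s then y else x t] t 0 (i t)
    = y 0 (i s) * \prod_(t < d | t != s) x t 0 (i t).
  rewrite (bigD1 s) //= ffunE eqxx; congr (_ * _).
  by apply: eq_bigr => t /negPf ts; rewrite ffunE ts.
by rewrite !E !mxE; ring.
Qed.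

Lemma coef_form_of_coef i : coef form_of_coef i = c i.
Proof.
rewrite /coef /form_of_coef (bigD1 i) //= [X in _ + X]big1 ?addr0.
  by rewrite big1 ?mulr1 // => s _; rewrite ffunE mxE !eqxx.
move=> i' ii'; have [s sE] : exists s, i' s != i s.
  apply/existsP; apply: contraNT ii'; rewrite negb_exists => /forallP E.
  by apply/eqP/ffunP => s; apply/eqP; have := E s; rewrite negbK.
by rewrite (bigD1 s) //= ffunE mxE (negPf sE) andbF mul0r mulr0.
Qed.

End FormOfCoef.

(** * The stability theorem *)

Theorem theoremB (R : realType) (d : nat) (hd : (2 <= d)%N) :
  exists C eps_d : R, 0 < eps_d /\
  forall (k : scalar_kind) (n : nat) (T : {ffun 'I_d -> 'rV[scalars R k]_n} -> scalars R k)
         (eps : R),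
  let q : R := 2 * d%:R / (d%:R + 1) in
  (1 <= n)%N ->
  multilinear T ->
  cb_norm T = 1%E ->
  1 - eps <= coef_norm q T ->
  0 <= eps <= eps_d ->
  exists (m : nat) (J : 'I_d -> {set 'I_n})
         (H : 'I_d.-1 -> 'M[scalars R k]_n)
         (P : {ffun 'I_d -> 'rV[scalars R k]_n} -> scalars R k),
  [/\ (1 <= m <= n)%N /\ (forall s, #|J s| = m),
      forall r a b, a \in J (link_src r) -> b \in J (link_tgt r) ->
        modulus (H r a b) = 1,
      [/\ multilinear P,
          forall i, i \in box J ->
            coef P i = of_real k (m%:R `^ (- ((d%:R + 1) / 2))) *
                       \prod_(r < d.-1) H r (i (link_src r)) (i (link_tgt r)) &
          forall i, i \notin box J -> coef P i = 0],
      coef_norm q (fun x => T x - P x) <= C * Num.sqrt eps /\ coef_norm q P = 1 &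
      \sum_(i | i \notin box J) modulus (coef T i) `^ q <= C * eps].
Proof.
pose S := size_const R d; pose tl := 2 * tail_const R d.
pose A := 2 * approx_const R d + 1.
have d1 : (0 < d)%N := ltnW hd.
have D0 : 0 <= d%:R :> R := ler0n _ _.
have S0 : 0 <= S := size_const_ge0 R d.
have tl0 : 0 <= tl by rewrite mulr_ge0 // tail_const_ge0.
have A1 : 1 <= A by rewrite /A; have := approx_const_ge0 R d; lra.
(* tl eps bounds the sum outside the box, and A eps / m the squared l2 error inside it *)
pose L := tl + 2 * A.
have L1 : 1 <= L by rewrite /L; move: tl0 A1; lra.
exists L, (4 * (S + 1))^-1; split.
  by rewrite invr_gt0 mulr_gt0 // ltr_wpDl.
move=> k n T eps q n1 _ Tcb Tq /andP[eps0 epsd].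
have qE : q = bh_exponent R d by [].
have q0 : 0 < q := bh_exponent_gt0 R d1.
have q1 : 1 <= q := bh_exponent_ge1 R d1.
have Seps : (S + 1) * eps <= 4^-1.
  have S1 : 0 < S + 1 by rewrite ltr_wpDl.
  have -> : 4^-1 = (S + 1) * (4 * (S + 1))^-1.
    by rewrite [(4 * _)^-1]invfM mulrCA mulfV ?mulr1 // gt_eqF.
  by apply: ler_wpM2l => //; exact: ltW.
have Seps0 : 0 <= S * eps by rewrite mulr_ge0.
pose v i := modulus (coef T i) `^ q.
have v0 i : 0 <= v i by exact: powR_ge0.
have vw i : v i ^+ d.+1 = modulus (coef T i) ^+ (2 * d).
  by apply: powq_exp => //; exact: modulus_ge0.
have v1 : 1 - 2 * eps <= \sum_i v i.
  have V0 : 0 <= \sum_i v i by exact: sumr_ge0.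
  have -> : \sum_i v i = coef_norm q T `^ q.
    by rewrite /coef_norm -powRrM mulVf ?powRr1 // gt_eqF.
  have e1 : 0 <= 1 - eps <= 1 by apply/andP; split; move: eps0 Seps Seps0; lra.
  apply: (@le_trans _ _ ((1 - eps) ^+ 2)).
    by rewrite sqrrB expr1n; have := sqr_ge0 eps; lra.
  apply: le_trans (sqr_le_powq d e1) _.
  have /andP[e10 _] := e1.
  by rewrite ge0_ler_powR ?nnegrE ?powR_ge0 // ltW.
have j0 : 'I_n := Ordinal n1.
have T1 : (cb_norm T <= 1)%E by rewrite Tcb.
have [m [J [H [m0 Jm H1 tail near]]]] := @coefficient_stability R k d n (coef T) v (2 * eps)
  v0 vw (fun s => slice_norm_minors j0 s T1) v1 hd ltac:(by rewrite mulr_ge0)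
  ltac:(by move: Seps; rewrite -/S; lra).
set u := (Num.sqrt (m%:R : R))^-1 in near.
have u0 : 0 <= u by rewrite invr_ge0 sqrtr_ge0.
have um : u ^+ 2 * m%:R = 1 := invsqrt_sqr R m0.
pose Q i := of_real k (u ^+ d.+1) * \prod_r H r (i (link_src r)) (i (link_tgt r)).
pose c i := if i \in box J then Q i else 0.
have modQ i : modulus (Q i) = u ^+ d.+1.
  by rewrite modulusM modulus_of_real modulus_prod big1 ?mulr1 ?ger0_norm ?exprn_ge0.
have uE : m%:R `^ (- ((d%:R + 1) / 2)) = u ^+ d.+1.
  by rewrite powRN mulrC powRrM powR12_sqrt // natr1 powR_mulrn ?sqrtr_ge0 // /u exprVn.
exists m, J, (fun r => \matrix_(x, y) H r x y), (form_of_coef c).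
have q_neq0 : q != 0 by rewrite gt_eqF.
split.
- split=> //; rewrite m0 /= -(Jm (Ordinal d1)) -[X in (_ <= X)%N]card_ord.
  exact: max_card.
- by move=> r x y _ _; rewrite mxE.
- split; first exact: form_of_coef_multilinear.
    move=> i iJ; rewrite coef_form_of_coef /c iJ uE; congr (_ * _).
    by apply: eq_bigr => r _; rewrite mxE.
  by move=> i /negPf iJ; rewrite coef_form_of_coef /c iJ.
- split; last first.
    rewrite /coef_norm (_ : \sum_i _ = 1) ?powR1 //.
    rewrite (bigID (mem (box J))) /= [X in _ + X]big1 ?addr0; last first.
      by move=> i /negPf iJ; rewrite coef_form_of_coef /c iJ modulus0 powR0.
    rewrite (eq_bigr (fun=> u ^+ (2 * d) * 1)) => [|i iJ]; last first.
      by rewrite coef_form_of_coef /c iJ modQ mulr1 exp_powq.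
    by rewrite -mulr_sumr (card_box _ Jm) exprM -exprMn um expr1n.
  have total : \sum_i modulus (coef (fun x => T x - form_of_coef c x) i) `^ q
      <= L * Num.sqrt eps `^ q.
    have coefE i : coef (fun x => T x - form_of_coef c x) i = coef T i - c i.
      by rewrite -(coef_form_of_coef c).
    rewrite (eq_bigr _ (fun i _ => congr1 (fun y => modulus y `^ q) (coefE i))).
    rewrite (bigID (mem (box J))) /=.
    have tailE : \sum_(i | i \notin box J) modulus (coef T i - c i) `^ q
        = \sum_(i | i \notin box J) v i.
      by apply: eq_bigr => i /negPf iJ; rewrite /c iJ subr0.
    rewrite tailE.
    have inner : \sum_(i in box J) modulus (coef T i - c i) `^ q
        <= 2 * (Num.sqrt A * Num.sqrt eps) `^ q.
      apply: (sum_powq_box d1 m0 (card_box R Jm)) => [i||].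
      - exact: modulus_ge0.
      - by rewrite mulr_ge0 ?sqrtr_ge0.
      rewrite exprMn !sqr_sqrtr ?(le_trans ler01 A1) //.
      rewrite (eq_bigr (fun i => modulus (coef T i - Q i) ^+ 2)) => [|i iJ]; last by rewrite /c iJ.
      apply: le_trans near _; apply: ler_wpM2r; first exact: sqr_ge0.
      by rewrite /A; move: eps0; lra.
    have sqA : Num.sqrt A `^ q <= A.
      have sA : 1 <= Num.sqrt A by rewrite -[1](sqrtr1 R) ler_wsqrtr.
      apply: le_trans (ler_powR sA (bh_exponent_le2 R d)) _.
      by rewrite powR_mulrn ?sqrtr_ge0 // sqr_sqrtr // (le_trans ler01).
    have sqe : eps <= Num.sqrt eps `^ q.
      rewrite -{1}(sqr_sqrtr eps0); apply: sqr_le_powq => //.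
      rewrite sqrtr_ge0 /= -[1](sqrtr1 R) ler_wsqrtr //.
      by move: Seps Seps0; lra.
    move: inner; rewrite powRM ?sqrtr_ge0 //.
    have e0 : 0 <= Num.sqrt eps `^ q := powR_ge0 _ _.
    have := ler_wpM2r e0 sqA; have := ler_wpM2l tl0 sqe; move: tail; rewrite /L /tl.
    set X := \sum_(i | _) v i; set Y := \sum_(i in _) _; set Z := _ `^ q; set W := _ `^ q.
    lra.
  have sL : (L * Num.sqrt eps `^ q) `^ q^-1 <= L * Num.sqrt eps.
    rewrite powRM ?powR_ge0 ?(le_trans ler01 L1) // -powRrM mulfV // powRr1 ?sqrtr_ge0 //.
    rewrite ler_wpM2r ?sqrtr_ge0 // ler1_powR //.
    by rewrite invf_le1.
  apply: le_trans sL; rewrite /coef_norm ge0_ler_powR ?nnegrE ?invr_ge0 ?(ltW q0) //.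
    by apply: sumr_ge0 => i _; exact: powR_ge0.
  by rewrite mulr_ge0 ?powR_ge0 ?(le_trans ler01 L1).
- apply: le_trans tail _; have := mulr_ge0 (le_trans ler01 A1) eps0.
  rewrite /L /tl; lra.
Qed.
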